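(* Let $0<a<\infty$ and let $U$ be a unitary $2\times2$ matrix. 1. If $U=I$, where $I$ is the $2\times2$ identity matrix, then the differential operator $\mathcal{L}_I$ commutes with the truncated Fourier operator $\mathscr{F}_{[-a,a]}$: $$\mathscr{F}_{[-a,a]}\mathcal{L}_I\,x=\mathcal{L}_I\mathscr{F}_{[-a,a]}\,x\quad\text{for all }x\in\mathcal{D}_{\mathcal{L}_I}.$$ 2. If $U\neq I$, then the operator $\mathcal{L}_U$ does not commute with $\mathscr{F}_{[-a,a]}$: (a) there exist $x\in\mathcal{D}_{\mathcal{L}_U}$ such that $\mathscr{F}_{[-a,a]}x\in\mathcal{D}_{\mathcal{L}_U}$ (so both operators $\mathscr{F}_{[-a,a]}\mathcal{L}_U$ and $\mathcal{L}_U\mathscr{F}_{[-a,a]}$ are applicable to $x$), but $\mathscr{F}_{[-a,a]}\mathcal{L}_Ux\neq\mathcal{L}_U\mathscr{F}_{[-a,a]}x$; (b) there exist $x\in\mathcal{D}_{\mathcal{L}_U}$ such that $\mathscr{F}_{[-a,a]}x\notin\mathcal{D}_{\mathcal{L}_U}$ (so the operator $\mathcal{L}_U\mathscr{F}_{[-a,a]}$ cannot even be applied to such $x$).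
   Context: Fix $0<a<\infty$. The truncated Fourier operator $\mathscr{F}_{[-a,a]}:L^2([-a,a])\to L^2([-a,a])$ is $(\mathscr{F}_{[-a,a]}x)(t)=\frac{1}{\sqrt{2\pi}}\int_{-a}^{a}e^{it\xi}x(\xi)\,d\xi$, $t\in[-a,a]$. The formal prolate spheroid differential operator is $(Lx)(t)=-\frac{d}{dt}\Big(\big(1-\frac{t^2}{a^2}\big)\frac{dx(t)}{dt}\Big)+t^2x(t)$, $-a<t<a$. $\mathcal{A}$ is the set of functions $x:(-a,a)\to\mathbb{C}$ that are differentiable at every point of $(-a,a)$ and whose derivative is absolutely continuous on every compact subinterval of $(-a,a)$. The maximal operator $\mathcal{L}_{\mathrm{max}}$ in $L^2((-a,a))$ has domain $\mathcal{D}_{\mathcal{L}_{\mathrm{max}}}=\{x\in L^2((-a,a))\cap\mathcal{A}: Lx\in L^2((-a,a))\}$ and acts by $\mathcal{L}_{\mathrm{max}}x=Lx$. For $x\in\mathcal{D}_{\mathcal{L}_{\mathrm{max}}}$ the following generalized boundary values exist as finite limits: $b_{-a}(x)=\lim_{t\to -a+0}(t+a)x'(t)$, $b_a(x)=\lim_{t\to a-0}(t-a)x'(t)$, $c_{-a}(x)=\lim_{t\to -a+0}\big((t+a)\ln(a+t)\,x'(t)-x(t)\big)$, $c_a(x)=\lim_{t\to a-0}\big((t-a)\ln(a-t)\,x'(t)-x(t)\big)$. For a complex $2\times2$ matrix $U=\|u_{pq}\|_{1\le p,q\le 2}$, the operator $\mathcal{L}_U$ is the restriction of $\mathcal{L}_{\mathrm{max}}$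 to the domain $\mathcal{D}_{\mathcal{L}_U}$ of all $x\in\mathcal{D}_{\mathcal{L}_{\mathrm{max}}}$ satisfying the boundary conditions $(1+u_{11})b_{-a}(x)-i(1-u_{11})c_{-a}(x)+u_{12}b_a(x)+iu_{12}c_a(x)=0$, $u_{21}b_{-a}(x)+iu_{21}c_{-a}(x)+(1+u_{22})b_a(x)-i(1-u_{22})c_a(x)=0$. $\mathcal{L}_I$ is $\mathcal{L}_U$ for $U=I$. Writing $\mathcal{L}_U y$ presupposes $y\in\mathcal{D}_{\mathcal{L}_U}$. *)

(* Defs.v *)
From HB Require Import structures.
From mathcomp Require Import all_boot all_order all_algebra.
From mathcomp Require Import all_classical all_reals all_analysis.
From mathcomp Require Import complex.
Import Order.TTheory GRing.Theory Num.Theory.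
Import numFieldNormedType.Exports.

Set Implicit Arguments.
Unset Strict Implicit.
Unset Printing Implicit Defensive.

Local Open Scope classical_set_scope.
Local Open Scope ring_scope.
Local Open Scope complex_scope.

(* Functions (-a, a) -> C are represented by total functions R -> R[i] of which
   only the values on ]-a, a[ matter.  Since R[i] carries no normed-module
   structure over R, the limit, derivative and integral of a C-valued function
   of a real variable are taken on the real and imaginary parts. *)

Section ComplexValued.
Variable R : realType.
Implicit Types (f x : R -> R[i]) (t : R).

Definition re_fun f : R -> R := fun t => complex.Re (f t).
Definition im_fun f : R -> R := fun t => complex.Im (f t).

Definition clim (F : set_system R) f : R[i] :=
  lim (re_fun f @ F) +i* lim (im_fun f @ F).

Definition cderivable f t : Prop :=
  derivable (re_fun f) t 1 /\ derivable (im_fun f) t 1.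

Definition cderiv f t : R[i] := derive1 (re_fun f) t +i* derive1 (im_fun f) t.

Definition cintegral (D : set R) f : R[i] :=
  (\int[lebesgue_measure]_(t in D) re_fun f t) +i*
  (\int[lebesgue_measure]_(t in D) im_fun f t).

Definition cis t : R[i] := cos t +i* sin t.

Definition abs_continuous (c d : R) f : Prop :=
  forall e : R, 0 < e -> exists2 delta : R, 0 < delta &
    forall (n : nat) (u v : 'I_n -> R),
      (forall k, c <= u k /\ u k <= v k /\ v k <= d) ->
      trivIset setT (fun k => `]u k, v k[%classic) ->
      \sum_(k < n) (v k - u k) < delta ->
      \sum_(k < n) Normc.normc (f (v k) - f (u k)) < e.

(* Measurability is Borel measurability; every class of L^2 has Borel
   representatives.  Equality in L^2 is equality almost everywhere, see
   [L2_eq]. *)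
Definition in_L2 (D : set R) f : Prop :=
  [/\ measurable_fun D (re_fun f), measurable_fun D (im_fun f) &
      (\int[lebesgue_measure]_(t in D) (Normc.normc (f t) ^+ 2)%:E < +oo)%E].

Definition L2_eq (D : set R) f g : Prop :=
  f = g %[ae lebesgue_measure in D].

End ComplexValued.

Section Prolate.
Variables (R : realType) (a : R).
Implicit Types (x : R -> R[i]) (t : R) (U : 'M[R[i]]_2).

Definition truncated_fourier x : R -> R[i] := fun t =>
  ((Num.sqrt (2 * pi))^-1)%:C *
  cintegral `[- a, a] (fun xi => cis (t * xi) * x xi).

(* At points where the second derivative does not exist (a null set when x lies
   in [smoothA]), the value is a junk value. *)
Definition prolate x : R -> R[i] := fun t =>
  - cderiv (fun s => (1 - s ^+ 2 / a ^+ 2)%:C * cderiv x s) t +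
  (t ^+ 2)%:C * x t.

Definition smoothA x : Prop :=
  (forall t, - a < t < a -> cderivable x t) /\
  (forall c d : R, - a < c -> c <= d -> d < a ->
     abs_continuous c d (cderiv x)).

Definition dom_Lmax x : Prop :=
  [/\ in_L2 `]- a, a[ x, smoothA x & in_L2 `]- a, a[ (prolate x)].

(* On [dom_Lmax] these four limits exist, so [lim] never takes its default
   value there. *)
Definition bv_bl x : R[i] :=
  clim (- a)^'+ (fun t => (t + a)%:C * cderiv x t).
Definition bv_br x : R[i] :=
  clim a^'- (fun t => (t - a)%:C * cderiv x t).
Definition bv_cl x : R[i] :=
  clim (- a)^'+ (fun t => ((t + a) * ln (a + t))%:C * cderiv x t - x t).
Definition bv_cr x : R[i] :=
  clim a^'- (fun t => ((t - a) * ln (a - t))%:C * cderiv x t - x t).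

Definition dom_LU U x : Prop :=
  [/\ dom_Lmax x,
      (1 + U 0 0) * bv_bl x - 'i%C * (1 - U 0 0) * bv_cl x
        + U 0 1 * bv_br x + 'i%C * U 0 1 * bv_cr x = 0 &
      U 1 0 * bv_bl x + 'i%C * U 1 0 * bv_cl x
        + (1 + U 1 1) * bv_br x - 'i%C * (1 - U 1 1) * bv_cr x = 0].

End Prolate.

(* Main.v *)
(** If x lies in the maximal domain, integrating the kernel e^{it xi} by parts
    against Lx, and using that L_t e^{it xi} = L_xi e^{it xi}, gives
      L F x (t) - F L x (t)
        = - (2 / (a sqrt (2 pi))) (b_a(x) e^{ita} + b_{-a}(x) e^{-ita}),
    so L and F commute on x exactly when b_a(x) = b_{-a}(x) = 0, which is the
    boundary condition for U = I.  Moreover F x is smooth up to the endpoints,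
    hence b(F x) = 0 and c(F x) = - F x at both endpoints, and F x satisfies the
    boundary conditions of U iff (I - U) (F x (-a), F x (a)) = 0.
    For U <> I choose w with (I - U) w <> 0.  The values b(x), c(x) and F x at
    the endpoints can be prescribed arbitrarily; b = 0, c = 0, F x = w gives
    (b), and b = i (I - U) w, c = (I + U) w, F x = 0 gives (a).  The integration
    by parts needs the fundamental theorem of calculus for absolutely continuous
    functions, obtained from the total variation, the Radon-Nikodym theorem and
    Lebesgue differentiation. *)

Require Import Defs.
From HB Require Import structures.
From mathcomp Require Import all_boot all_order all_algebra.
From mathcomp Require Import all_classical all_reals all_analysis.
From mathcomp Require Import measurable_realfun complex spectral ring lra.
Import Order.TTheory GRing.Theory Num.Theory.
Import numFieldNormedType.Exports.

Local Open Scope classical_set_scope.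
Local Open Scope ring_scope.
Local Open Scope complex_scope.

(** * Absolutely continuous functions *)

(** The obstacle lies at the endpoints: x' is absolutely continuous on compact subintervals only,
    and x may be unbounded near -a and a. Green's identity is therefore proved inside the interval
    and pushed to the boundary. With p(t) = 1 - t^2/a^2, every Wronskian p (k x' - k' x) has
    endpoint limits because its derivative (Lk) x - k (Lx) is integrable on the whole interval. The
    choice k = 1 gives the limits b; boundedness of (t - a) x' and (t + a) x' then lets x grow at
    most logarithmically, so p x tends to 0 and the term with k' disappears.

    Boundary data are prescribed with x = b_{-a} ln(a + t) + b_a ln(a - t) + g. The logarithms carry
    b, an affine part of g carries c, and multiples of (a^2 - t^2) cos(a t) and (a^2 - t^2) sin(a
    t), which vanish at the endpoints, carry the values of F x there.

    In matrix form the boundary conditions read (I + U) b = i (I - U) c. Since I + U and I - U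
    commute, b = i (I - U) w and c = (I + U) w solve them for every w. *)

Section AbsoluteContinuity.
Context {R : realType}.
Implicit Types (c d : R) (f g : R -> R) (p q : R * R) (s : seq (R * R)).

(** Weak inequalities, so that consecutive pieces of a partition are separated although they share
    an endpoint. *)
Definition itv_sep p q := (p.2 <= q.1) || (q.2 <= p.1).

Definition sub_itv c d p := (c <= p.1) && (p.1 <= p.2) && (p.2 <= d).

Definition tot_len s : R := \sum_(p <- s) (p.2 - p.1).

Definition osc f s : R := \sum_(p <- s) `|f p.2 - f p.1|.

(** The pair ([e], [dl]) is kept explicit because one [dl] has to serve again for subintervals and
    for the total variation of [f]. *)
Definition abs_cont_modulus c d f (e dl : R) := forall s,
  all (sub_itv c d) s -> pairwise itv_sep s -> tot_len s < dl -> osc f s < e.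

Definition abs_cont c d f :=
  forall e : R, 0 < e -> exists2 dl : R, 0 < dl & abs_cont_modulus c d f e dl.

Lemma itv_sepC : symmetric itv_sep.
Proof. by move=> p q; rewrite /itv_sep orbC. Qed.

Lemma abs_cont_modulusS c d x y f e dl : c <= x -> y <= d ->
  abs_cont_modulus c d f e dl -> abs_cont_modulus x y f e dl.
Proof.
move=> cx yd H s /allP sP; apply: H; apply/allP => p /sP /andP[/andP[h1 h2] h3].
by apply/andP; split; [apply/andP; split => //|]; lra.
Qed.

Lemma path_subitv (a : R) (s : seq R) b : path <%R a s -> last a s = b ->
  all (sub_itv a b) (zip (a :: s) s).
Proof.
elim: s a => // x s IH a /= /andP[ax xs] lb.
have xb : x <= b.
  rewrite -lb; have := mem_last x s; rewrite inE => /predU1P[->//|].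
  by move=> /(allP (order_path_min lt_trans xs))/ltW.
rewrite /sub_itv /= lexx (ltW ax) xb /=.
have /allP H := IH _ xs lb; apply/allP => p /H /andP[/andP[h1 h2] h3].
by rewrite (le_trans (ltW ax) h1) h2 h3.
Qed.

Lemma path_pairwise (a : R) (s : seq R) : path <%R a s ->
  pairwise itv_sep (zip (a :: s) s).
Proof.
elim: s a => // x s IH a /= /andP[ax xs]; rewrite IH // andbT.
have /allP H := path_subitv _ _ _ xs erefl.
by apply/allP => p /H /andP[/andP[h1 _] _]; rewrite /itv_sep /= h1.
Qed.

Lemma path_tot_len (a : R) (s : seq R) :
  tot_len (zip (a :: s) s) = last a s - a.
Proof.
rewrite /tot_len; elim: s a => [|x s IH] a /=; first by rewrite big_nil subrr.
by rewrite big_cons IH /=; ring.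
Qed.

Lemma path_osc f (a b : R) (s : seq R) :
  osc f (zip (a :: s) s) = variation a b f s.
Proof.
rewrite /osc; elim: s a => [|x s IH] a /=.
  by rewrite big_nil variation_nil.
by rewrite big_cons IH /variation /= big_nat_recl.
Qed.

(** A partition of an interval shorter than [dl] is itself an admissible family, so every variation
    stays below 1. *)
Lemma abs_cont_TV_fin_small {c d f dl x y} : abs_cont_modulus c d f 1 dl -> c <= x -> x <= y -> y <= d ->
  y - x < dl -> total_variation x y f \is a fin_num.
Proof.
move=> H cx xy yd yx; apply/(bounded_variationP _ xy); exists 1 => _ [s [ps /eqP ls] <-].
rewrite -path_osc; apply/ltW; apply: (abs_cont_modulusS _ _ _ _ _ _ _ cx yd H).
- exact: path_subitv.
- exact: path_pairwise.
- by rewrite path_tot_len ls.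
Qed.

Lemma abs_cont_TV_fin {c d f} : abs_cont c d f -> c <= d ->
  forall x y, c <= x -> x <= y -> y <= d -> total_variation x y f \is a fin_num.
Proof.
move=> H cd; have [dl dl0 Hdl] := H 1 ltr01.
(* Induction on the number of pieces of length [dl / 2]; the half turns the weak bound on a piece
   into the strict one required by the modulus. *)
suff K n : forall x y, c <= x -> x <= y -> y <= d -> y - x <= n%:R * (dl / 2) ->
    total_variation x y f \is a fin_num.
  move=> x y cx xy yd.
  have h0 : 0 <= (y - x) / (dl / 2) by apply: divr_ge0; lra.
  apply: (K (Num.truncn ((y - x) / (dl / 2))).+1) => //.
  have := ltW (truncnS_gt ((y - x) / (dl / 2))).
  by rewrite ler_pdivrMr // divr_gt0.
elim: n => [|n IH] x y cx xy yd yx.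
  by apply: (abs_cont_TV_fin_small Hdl) => //; move: yx; rewrite mul0r; lra.
have [small|big] := leP (y - x) (dl / 2); first by apply: (abs_cont_TV_fin_small Hdl) => //; lra.
rewrite (@total_variationD _ _ _ (x + dl / 2)); [|lra|lra].
rewrite fin_numD; apply/andP; split.
  by apply: (abs_cont_TV_fin_small Hdl) => //; lra.
by apply: IH; [lra|lra|lra|move: yx; rewrite -natr1; lra].
Qed.

Lemma sub_itvS p q r c d : sub_itv q.1 q.2 p -> sub_itv c d q -> itv_sep q r ->
  sub_itv c d p /\ itv_sep p r.
Proof.
move=> /andP[/andP[h1 h2] h3] /andP[/andP[g1 g2] g3] qr; split.
  by apply/andP; split; [apply/andP; split => //|]; lra.
by case/orP: qr => h; apply/orP; [left|right]; lra.
Qed.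

(* The intervals of [s1] are replaced one at a time by the pieces of a
   partition, which are moved to [s2]; taking the supremum over the partition
   only then avoids any splitting of [e]. *)
Lemma sum_TV_le {c d f e dl} : abs_cont c d f -> c <= d -> abs_cont_modulus c d f e dl ->
  forall s1 s2, all (sub_itv c d) (s1 ++ s2) -> pairwise itv_sep (s1 ++ s2) ->
  tot_len (s1 ++ s2) < dl ->
  (\sum_(p <- s1) total_variation p.1 p.2 f + (osc f s2)%:E <= e%:E)%E.
Proof.
move=> acf cd Hdl; elim=> [|p s1 IH] s2 /= h1 h2 h3.
  by rewrite big_nil add0e lee_fin; apply/ltW/Hdl.
have fin q : q \in s1 -> total_variation q.1 q.2 f \is a fin_num.
  move=> qs; move: h1 => /andP[_ /allP/(_ q)]; rewrite mem_cat qs => /(_ isT).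
  by case/andP => /andP[? ?] ?; exact: (abs_cont_TV_fin acf).
rewrite big_cons -addeA -leeBrDr; last first.
  by rewrite fin_numD andbT; apply/sum_fin_numP => q qs _; exact: fin.
rewrite /total_variation; apply: ge_ereal_sup => _ [_ [s [ps /eqP ls] <-] <-].
rewrite leeBrDr; last first.
  by rewrite fin_numD andbT; apply/sum_fin_numP => q qs _; exact: fin.
rewrite addeCA -EFinD.
rewrite -path_osc /osc -big_cat -/(osc f (_ ++ _)).
case/andP: h1 => h1p h1; case/andP: h2 => h2p h2.
have sub := path_subitv _ _ _ ps ls.
apply: IH.
- move: h1; rewrite !all_cat => /andP[-> ->]; rewrite andbT /=.
  apply/allP => q /(allP sub) qp.
  by case: (sub_itvS q p (p.1, p.1) c d) => //; rewrite /itv_sep /= lexx orbT.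
- move: h2 h2p; rewrite !pairwise_cat => /and3P[h4 -> ->].
  rewrite (path_pairwise _ _ ps) all_cat => /andP[k1 k2]; rewrite /= !andbT.
  apply/andP; split.
    rewrite allrel_catr h4 andbT; apply/allrelP => q r qs rs.
    rewrite itv_sepC.
    by case: (sub_itvS r p q c d) => //; [exact: (allP sub)|exact: (allP k1)].
  apply/allrelP => r q rs qs.
  by case: (sub_itvS r p q c d) => //; [exact: (allP sub)|exact: (allP k2)].
- move: h3; rewrite /tot_len !big_cat /= big_cons big_cat /=.
  rewrite -/(tot_len (zip (p.1 :: s) s)) path_tot_len ls.
  by rewrite addrCA.
Qed.

(** The increments of the variation function are total variations over the intervals of the family,
    which [sum_TV_le] bounds. That bound is weak, whence [e / 2]. *)
Lemma abs_cont_TV {c d f} : abs_cont c d f -> c <= d ->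
  abs_cont c d (fun x => fine (total_variation c x f)).
Proof.
move=> acf cd e e0; have e2 : 0 < e / 2 by lra.
have [dl dl0 Hdl] := acf _ e2; exists dl => // s h1 h2 h3.
have := sum_TV_le acf cd Hdl s [::]; rewrite cats0 => /(_ h1 h2 h3).
rewrite [osc f _]/osc big_nil adde0 => H.
have E p : p \in s -> total_variation p.1 p.2 f =
    (`|fine (total_variation c p.2 f) - fine (total_variation c p.1 f)|)%:E.
  move=> /(allP h1) /andP[/andP[h4 h5] h6].
  have F1 := abs_cont_TV_fin acf cd _ _ (lexx c) h4 (le_trans h5 h6).
  have F2 := abs_cont_TV_fin acf cd _ _ h4 h5 h6.
  rewrite (@total_variationD _ c p.2 p.1 f) // fineD // addrAC subrr add0r.
  by rewrite ger0_norm ?fineK // fine_ge0 // total_variation_ge0.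
rewrite (le_lt_trans _ (_ : e / 2 < e)) //; last lra.
rewrite -lee_fin; apply: le_trans H; rewrite /osc -sumEFin.
by rewrite big_seq [X in (_ <= X)%E]big_seq; apply: lee_sum => p ps; rewrite E.
Qed.

Lemma abs_contB {c d f g} : abs_cont c d f -> abs_cont c d g -> abs_cont c d (f \- g).
Proof.
move=> acf acg e e0; have e2 : 0 < e / 2 by lra.
have [d1 d10 H1] := acf _ e2; have [d2 d20 H2] := acg _ e2.
exists (Num.min d1 d2) => [|s h1 h2 h3]; first by rewrite lt_min d10.
move: h3; rewrite lt_min => /andP[h3 h4].
have := H1 s h1 h2 h3; have := H2 s h1 h2 h4.
have : osc (f \- g) s <= osc f s + osc g s.
  rewrite /osc -big_split /=; apply: ler_sum => p _.
  rewrite (_ : f p.2 - g p.2 - _ = (f p.2 - f p.1) - (g p.2 - g p.1)); last ring.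
  exact: ler_normB.
by lra.
Qed.

(* Absolute continuity only speaks of disjoint intervals; overlapping intervals
   are replaced by their hull, which does not increase the total length. *)
Lemma merge_cover s : all (fun p => p.1 <= p.2) s ->
  exists s', [/\ all (fun p => p.1 <= p.2) s', pairwise itv_sep s',
    tot_len s' <= tot_len s &
    forall x, (exists2 p, p \in s & p.1 < x <= p.2) ->
              (exists2 p, p \in s' & p.1 < x <= p.2)].
Proof.
elim: s => [|p s IH] /=; first by exists [::]; split.
case/andP => hp /IH [s' [a1 a2 a3 a4]].
suff [s2 [b1 b2 b3 b4]] : exists s2, [/\ all (fun p => p.1 <= p.2) s2,
    pairwise itv_sep s2, tot_len s2 <= tot_len (p :: s') &
    forall x, (exists2 q, q \in p :: s' & q.1 < x <= q.2) ->
              (exists2 q, q \in s2 & q.1 < x <= q.2)].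
  exists s2; split => //.
    by move: b3 a3; rewrite /tot_len !big_cons; lra.
  move=> x [q]; rewrite inE => /orP[/eqP ->|qs] qx; apply: b4.
    by exists p => //; rewrite mem_head.
  have [q' q's qx'] := a4 x (ex_intro2 _ _ q qs qx).
  by exists q' => //; rewrite inE q's orbT.
(* The hull of [p] and one interval may meet further ones. Each merge removes a member of the list,
   hence the induction on its size. *)
have [n] := ubnP (size s'); elim: n p s' hp a1 a2 {s IH a3 a4} => // n IH p s hp a1 a2 sn.
have [hs|] := boolP (has (fun q => ~~ itv_sep p q) s); last first.
  rewrite -all_predC => H; exists (p :: s); split => //=; first by rewrite hp.
  by rewrite a2 andbT; apply: sub_all H => q /=; rewrite negbK.
have /hasP[q qs] := hs; rewrite /itv_sep negb_or -!ltNge => /andP[pq qp].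
have hq := allP a1 q qs.
pose p' : R * R := (Num.min p.1 q.1, Num.max p.2 q.2).
have hp' : p'.1 <= p'.2.
  by rewrite /p' /= ge_min le_max hp.
have sperm := perm_to_rem qs.
have [|||s2 [b1 b2 b3 b4]] := IH p' (rem q s) hp'.
- by apply/allP => r /mem_rem /(allP a1).
- exact: subseq_pairwise (rem_subseq q s) a2.
- by rewrite size_rem // prednK ?(leq_trans _ sn) //; case: (s) qs.
- exists s2; split => //.
    apply: (le_trans b3); rewrite /tot_len !big_cons (perm_big _ sperm) big_cons /=.
    rewrite addrA lerD2r /Num.min /Num.max.
    by case: ltP => ?; case: ltP => ?; lra.
  move=> x [r]; rewrite inE (perm_mem sperm) inE => /or3P[/eqP->|/eqP->|rs] rx; apply: b4.
  + by exists p'; [rewrite mem_head|rewrite /p' /= gt_min le_max; case/andP: rx => -> ->].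
  + by exists p'; [rewrite mem_head|rewrite /p' /= gt_min le_max; case/andP: rx => -> ->; rewrite !orbT].
  + by exists r => //; rewrite inE rs orbT.
Qed.

End AbsoluteContinuity.

(** * Densities of nondecreasing absolutely continuous functions *)

Section Density.
Context {R : realType}.
Notation mu := (@lebesgue_measure R).
Implicit Types (c d : R) (f g : R -> R).

(** Composition with this monotone 1-Lipschitz retraction extends a function on [c, d] to the line
    by constants and preserves moduli of continuity. *)
Definition clamp c d (x : R) := Num.max c (Num.min d x).

Lemma clamp_in c d x : c <= d -> c <= clamp c d x <= d.
Proof. by move=> cd; rewrite le_max lexx ge_max cd ge_min lexx. Qed.

Lemma clamp_id c d x : c <= x <= d -> clamp c d x = x.
Proof. by case/andP => cx xd; rewrite /clamp (min_idPr xd) (max_idPr cx). Qed.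

Lemma le_clamp c d x y : x <= y -> clamp c d x <= clamp c d y.
Proof.
move=> xy; rewrite /clamp !maxEle !minEle; case: (leP d x) => ?; case: (leP d y) => ?;
  by case: (leP c d) => ?; case: (leP c x) => ?; case: (leP c y) => ?; lra.
Qed.

Lemma clampB c d x y : x <= y -> clamp c d y - clamp c d x <= y - x.
Proof.
move=> xy; rewrite /clamp !maxEle !minEle; case: (leP d x) => ?; case: (leP d y) => ?;
  by case: (leP c d) => ?; case: (leP c x) => ?; case: (leP c y) => ?; lra.
Qed.

Lemma clamp_sub c d x y : c <= d -> x <= y -> sub_itv c d (clamp c d x, clamp c d y).
Proof.
move=> cd xy; rewrite /sub_itv /= le_clamp //.
by have /andP[-> _] := clamp_in c d x cd; have /andP[_ ->] := clamp_in c d y cd.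
Qed.

Lemma abs_cont_clamp_small c d f e dl x y : c <= d -> abs_cont_modulus c d f e dl ->
  x <= y -> y - x < dl -> `|f (clamp c d y) - f (clamp c d x)| < e.
Proof.
move=> cd H xy xydl; have := H [:: (clamp c d x, clamp c d y)].
rewrite /osc /tot_len !big_seq1 /=; apply => //.
  by rewrite clamp_sub.
exact: le_lt_trans (clampB c d _ _ xy) xydl.
Qed.

Lemma abs_cont_clamp_right_continuous c d f : c <= d -> abs_cont c d f ->
  right_continuous (f \o clamp c d).
Proof.
move=> cd acf x; apply/cvgrPdist_lt => e e0.
have [dl dl0 Hdl] := acf _ e0; near=> y; rewrite distrC.
apply: (abs_cont_clamp_small _ _ _ _ _ _ _ cd Hdl); first by near: y; exact: nbhs_right_ge.
rewrite ltrBlDl; near: y; apply: nbhs_right_lt; lra.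
Unshelve. all: by end_near. Qed.

Lemma measure_bigU_seq (nu : {measure set (measurableTypeR R) -> \bar R}) (s : seq (R * R)) :
  (nu (\big[setU/set0]_(p <- s) `]p.1, p.2]%classic) <=
   \sum_(p <- s) nu `]p.1, p.2]%classic)%E.
Proof.
elim: s => [|p s IH]; first by rewrite !big_nil measure0.
rewrite !big_cons; apply: le_trans (measureU2 _ _ _) _ => //.
- by apply: bigsetU_measurable => q _; exact: measurable_itv.
- exact: leeD2l.
Qed.

(** Absolute continuity of [g] makes its Lebesgue-Stieltjes measure absolutely continuous with
    respect to [mu]; [h] is the Radon-Nikodym density. *)
Lemma nondecreasing_abs_cont_density c d g : c <= d -> {in `[c, d] &, {homo g : x y / x <= y}} ->
  abs_cont c d g ->
  exists h : R -> R, mu.-integrable [set: R] (EFin \o h) /\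
    forall x y, c <= x -> x <= y -> y <= d ->
      g y - g x = \int[mu]_(t in `]x, y]) h t.
Proof.
move=> cd ndg acg.
pose k := g \o clamp c d.
have ndk : {homo k : x y / x <= y}.
  by move=> x y xy; apply: ndg; rewrite ?in_itv /= ?clamp_in ?le_clamp.
have rck := abs_cont_clamp_right_continuous _ _ _ cd acg.
pose kc : cumulative R R := HB.pack k (isCumulative.Build R _ R k ndk rck).
pose nu : {measure set (measurableTypeR R) -> \bar R} := lebesgue_stieltjes_measure kc.
have nuE x y : x <= y -> nu `]x, y]%classic = (k y - k x)%:E.
  move=> xy; rewrite /nu /lebesgue_stieltjes_measure /measure_extension.
  have m : measurable (`]x, y]%classic : set (ocitv_type R)) by exists (x, y).
  transitivity (wlength kc `]x, y]%classic); first exact: measurable_mu_extE.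
  exact: wlength_itv_bnd.
(* A null set has covers by half-open intervals of total length below [dl]. The modulus bounds [nu]
   by [e] on their finite unions, and continuity from below extends the bound to the whole cover. *)
have nu_dom : content_dominates mu nu.
  move=> A mA A0; apply/eqP; rewrite eq_le measure_ge0 andbT.
  apply/lee_addgt0Pr => e e0; rewrite add0e.
  have [dl dl0 Hdl] := acg _ e0.
  have : (ereal_inf [set \sum_(k <oo) wlength idfun (F k) | F in
            measurable_cover (A : set (ocitv_type R))] < dl%:E)%E.
    by rewrite (_ : ereal_inf _ = 0%:E) ?lte_fin //; exact: A0.
  case/ereal_inf_lt => _ [F [mF AF] <-] Fdl.
  have : forall n, exists p : R * R, p.1 <= p.2 /\ F n = `]p.1, p.2]%classic.
    move=> n; have [[u v] _ <-] := mF n.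
    have [uv|vu] := leP u v; first by exists (u, v).
    (* An empty member with reversed endpoints is rewritten as []u, u]], so that the difference of
       its endpoints is its length. *)
    exists (u, u); split => //=.
    by rewrite !set_itv_ge // bnd_simp -leNgt // ltW.
  move/choice => [p /all_and2[p12 FE]].
  have lenF n : (\sum_(i < n) ((p i).2 - (p i).1) < dl).
    rewrite -lte_fin -sumEFin; apply: le_lt_trans Fdl.
    rewrite (_ : (\sum_(i < n) _)%E = (\sum_(0 <= i < n) wlength idfun (F i))%E).
      by apply: nneseries_lim_ge => i _ _; exact: wlength_ge0.
    rewrite big_mkord; apply: eq_bigr => i _.
    by rewrite FE wlength_itv_bnd.
  have mF' i : measurable (F i : set (measurableTypeR R)).
    by rewrite FE; exact: measurable_itv.
  have nuF n : (nu (\big[setU/set0]_(i < n) F i) <= e%:E)%E.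
    pose s := [seq p i | i <- iota 0 n].
    (* The members of the cover may overlap, whereas the modulus speaks of separated intervals. *)
    have [|s' [s'1 s'2 s'3 s'4]] := merge_cover s.
      by apply/allP => _ /mapP[i _ ->].
    have sub : \big[setU/set0]_(i < n) F i `<=` \big[setU/set0]_(p <- s') `]p.1, p.2]%classic.
      move=> x; rewrite -bigcup_mkord => -[i /= ilt]; rewrite FE /= in_itv /= => xi.
      rewrite -bigcup_seq; have [|q qs' qx] := s'4 x.
        by exists (p i) => //; apply/mapP; exists i => //; rewrite mem_iota.
      by exists q => //=; rewrite in_itv.
    apply: (@le_trans _ _ (nu (\big[setU/set0]_(p <- s') `]p.1, p.2]%classic))).
      apply: le_measure => //; rewrite inE; exact: bigsetU_measurable.
    apply: le_trans (measure_bigU_seq _ _) _.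
    (* [nu] sees an interval through the increment of [g] between its clamped ends; clamping neither
       lengthens intervals nor destroys their separation. *)
    pose s2 := [seq (clamp c d q.1, clamp c d q.2) | q <- s'].
    have : osc g s2 < e.
      apply: Hdl.
      - by apply/allP => _ /mapP[q qs' ->]; apply: clamp_sub => //; exact: (allP s'1).
      - rewrite pairwise_map; apply: sub_pairwise s'2 => q r /= /orP[] h.
          by apply/orP; left; apply: le_clamp.
        by apply/orP; right; apply: le_clamp.
      - apply: (@le_lt_trans _ _ (tot_len s')).
          rewrite /tot_len big_map big_seq [leRHS]big_seq; apply: ler_sum => q qs'.
          by apply: clampB; exact: (allP s'1).
        apply: le_lt_trans s'3 _; rewrite /tot_len big_map.
        by rewrite -[X in iota 0 X]subn0 -/(index_iota 0 n) big_mkord.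
    move=> /ltW; rewrite -lee_fin; apply: le_trans.
    rewrite /osc big_map -sumEFin big_seq [leRHS]big_seq; apply: lee_sum => q qs'.
    have q12 := allP s'1 _ qs'.
    by rewrite [leLHS](nuE _ _ q12) lee_fin ler_norm.
  have ndF : nondecreasing_seq (fun n => \big[setU/set0]_(i < n) F i).
    by move=> m n mn; rewrite -!bigcup_mkord subsetEset; apply: bigcup_subset => i /= /leq_trans; apply.
  have mU n : measurable (\big[setU/set0]_(i < n) F i : set (measurableTypeR R)).
    exact: bigsetU_measurable.
  have mUU : measurable (\bigcup_n \big[setU/set0]_(i < n) F i : set (measurableTypeR R)).
    exact: bigcup_measurable.
  have cv := @nondecreasing_cvg_mu _ _ _ nu _ mU mUU ndF.
  have E := cvg_lim (@ereal_hausdorff R) cv.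
  apply: (@le_trans _ _ (nu (\bigcup_n \big[setU/set0]_(i < n) F i))).
    apply: le_measure; rewrite ?inE // => x /AF [i _ xi].
    by exists i.+1 => //; rewrite big_ord_recr /=; right.
  rewrite -E; apply: lime_le.
    exact: cvgP cv.
  by apply: nearW => n; exact: nuF.
have mD : measurable (`]c, d]%classic : set (measurableTypeR R)) by exact: measurable_itv.
have Doo : (nu `]c, d]%classic < +oo)%E by rewrite nuE // ltry.
(* Restriction to []c, d]] gives the finite measure to which the Radon-Nikodym theorem is
   applied. *)
pose nuD : {finite_measure set (measurableTypeR R) -> \bar R} := mfrestr mD Doo.
have dom : nuD `<< mu.
  apply/null_content_dominatesP => A mA A0; apply: nu_dom.
    exact: measurableI.
  by apply/eqP; rewrite eq_le measure_ge0 andbT -A0 le_measure ?inE //; exact: measurableI.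
have [h [h0 hfin hint hE]] := radon_nikodym_sigma_finite dom.
exists (fine \o h).
have hfine : EFin \o (fine \o h) = h by apply/funext => x /=; rewrite fineK.
split; first by rewrite hfine.
move=> x y cx xy yd.
rewrite /Rintegral.
rewrite -[X in integral _ _ X]/(EFin \o (fine \o h)) hfine -hE; last exact: measurable_itv.
rewrite /nuD /= /mfrestr /mrestr setIidl; last first.
  by move=> z; rewrite /= !in_itv /= => /andP[xz zy]; apply/andP; split; lra.
by rewrite nuE //= /k /= !clamp_id //; lra.
Qed.

End Density.

(** * The fundamental theorem of calculus for absolutely continuous functions *)

Section FundamentalTheorem.
Context {R : realType}.
Notation mu := (@lebesgue_measure R).
Implicit Types (c d : R) (f g : R -> R).

(** Jordan decomposition: with [G] the variation function, [f] is [G - (G - f)], a difference of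
    nondecreasing absolutely continuous functions. *)
Lemma abs_cont_density c d f : c <= d -> abs_cont c d f ->
  exists h : R -> R, mu.-integrable [set: R] (EFin \o h) /\
    forall x y, c <= x -> x <= y -> y <= d ->
      f y - f x = \int[mu]_(t in `]x, y]) h t.
Proof.
move=> cd acf; pose G x := fine (total_variation c x f).
have GE x y : c <= x -> x <= y -> y <= d ->
    (G y - G x)%:E = total_variation x y f.
  move=> cx xy yd; have F1 := abs_cont_TV_fin acf cd _ _ (lexx c) cx (le_trans xy yd).
  have F2 := abs_cont_TV_fin acf cd _ _ cx xy yd.
  by rewrite /G (@total_variationD _ c y x f) // fineD // addrAC subrr add0r fineK.
have GN x y : c <= x -> x <= y -> y <= d -> `|f y - f x| <= G y - G x.
  by move=> cx xy yd; rewrite -lee_fin GE // total_variation_ge.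
have acG : abs_cont c d G by exact: abs_cont_TV.
have [|h1 [i1 E1]] := nondecreasing_abs_cont_density _ _ _ cd _ acG.
  move=> x y; rewrite !in_itv /= => /andP[cx _] /andP[_ yd] xy.
  by have := GN _ _ cx xy yd; have := normr_ge0 (f y - f x); lra.
have [|h2 [i2 E2]] := nondecreasing_abs_cont_density _ _ (G \- f) cd _ (abs_contB acG acf).
  move=> x y; rewrite !in_itv /= => /andP[cx _] /andP[_ yd] xy.
  by have := GN _ _ cx xy yd; have := ler_norm (f y - f x); lra.
exists (h1 \- h2); split.
  rewrite (_ : EFin \o _ = (EFin \o h1) \- (EFin \o h2))%E //.
  exact: integrableB.
move=> x y cx xy yd.
rewrite RintegralB //=; first last.
- by apply: integrableS i2 => //; exact: measurable_itv.
- by apply: integrableS i1 => //; exact: measurable_itv.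
- by rewrite -E1 // -E2 //=; ring.
Qed.

Lemma abs_cont_ae_derivable c d f : c <= d -> abs_cont c d f ->
  exists h : R -> R, [/\ mu.-integrable [set: R] (EFin \o h),
    forall x y, c <= x -> x <= y -> y <= d ->
      f y - f x = \int[mu]_(t in `]x, y]) h t &
    {ae mu, forall x, c < x < d -> derivable f x 1 /\ derive1 f x = h x}].
Proof.
move=> cd acf; have [h [ih hE]] := abs_cont_density _ _ _ cd acf.
exists h; split => //.
have loch : locally_integrable [set: R] h.
  by have := integrable_locally measurableT ih; rewrite patch_setT.
have ihy y : mu.-integrable [set` Interval (BRight c) (BRight y)] (EFin \o h).
  by apply: integrableS ih => //; exact: measurable_itv.
have := FTC1 ihy loch.
apply: filterS; first exact: (ae_filter_ringOfSetsType mu).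
move=> x H /andP[cx xd]; have [|D E] := H; first by rewrite lte_fin.
have nr : \forall z \near x, \int[mu]_(t in `]c, z]) h t + f c = f z.
  have : x \in `]c, d[ by rewrite in_itv /= cx.
  move=> /near_in_itvoo; apply: filterS => z; rewrite in_itv /= => /andP[cz zd].
  by rewrite -(hE c z) ?subrK // ltW.
have DF : is_derive x 1 f (h x).
  apply: near_eq_is_derive nr _; rewrite -E derive1E -[X in is_derive _ _ _ X]addr0.
  by apply: is_deriveD; exact/derivableP.
by split; [exact: ex_derive|rewrite derive1E derive_val].
Qed.

(** The value of the derivative is asked for only where [f] is derivable, because derivability
    almost everywhere comes from absolute continuity. *)
Lemma abs_cont_integral c d f w : c <= d -> abs_cont c d f ->
  mu.-integrable `[c, d] (EFin \o w) ->
  {ae mu, forall x, c < x < d -> derivable f x 1 -> derive1 f x = w x} ->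
  f d - f c = \int[mu]_(x in `[c, d]) w x.
Proof.
move=> cd acf iw aew; have [h [ih hE aeh]] := abs_cont_ae_derivable _ _ _ cd acf.
have mcd : measurable (`[c, d]%classic : set (measurableTypeR R)) by exact: measurable_itv.
have ih' : mu.-integrable `[c, d] (EFin \o h) by apply: integrableS ih.
rewrite hE // Rintegral_itv_obnd_cbnd; last by apply: integrableS ih => //; exact: measurable_itv.
congr fine; apply: ae_eq_integral => //.
- exact: measurable_int ih'.
- exact: measurable_int iw.
have nc : {ae mu, forall x, x != c}.
  exists [set c]; split; [exact: measurable_set1|exact: lebesgue_measure_set1|].
  by move=> x /= /negP; rewrite negbK => /eqP.
have nd : {ae mu, forall x, x != d}.
  exists [set d]; split; [exact: measurable_set1|exact: lebesgue_measure_set1|].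
  by move=> x /= /negP; rewrite negbK => /eqP.
have ncd := @filterI _ _ (ae_filter_ringOfSetsType mu) _ _ nc nd.
move: aew aeh ncd; apply: filterS3; first exact: (ae_filter_ringOfSetsType mu).
move=> x xw xh [/= xc xd] /=; rewrite in_itv /= => /andP[cx xd'].
have H : c < x < d by rewrite !lt_neqAle cx xd' eq_sym xc xd.
by have [D <-] := xh H; rewrite xw.
Qed.

Lemma lipschitz_abs_cont c d f K : 0 <= K ->
  (forall x y, c <= x -> x <= y -> y <= d -> `|f y - f x| <= K * (y - x)) ->
  abs_cont c d f.
Proof.
move=> K0 H e e0; have K1 : 0 < K + 1 by lra.
exists (e / (K + 1)) => [|s s1 _]; first exact: divr_gt0.
rewrite ltr_pdivlMr // mulrC => s2; apply: le_lt_trans s2.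
rewrite /osc /tot_len mulr_sumr big_seq [leRHS]big_seq; apply: ler_sum => p ps.
have /andP[/andP[h1 h2] h3] := allP s1 p ps.
apply: le_trans (H _ _ h1 h2 h3) _; apply: ler_wpM2r; lra.
Qed.

Lemma abs_cont_bounded c d f : c <= d -> abs_cont c d f ->
  exists2 B : R, 0 < B & forall x, c <= x <= d -> `|f x| <= B.
Proof.
move=> cd acf; have T := abs_cont_TV_fin acf cd _ _ (lexx c) cd (lexx d).
have T0 : 0 <= fine (total_variation c d f) by rewrite fine_ge0 // total_variation_ge0.
exists (`|f c| + fine (total_variation c d f) + 1) => [|x /andP[cx xd]].
  by have := normr_ge0 (f c); lra.
have : `|f x - f c| <= fine (total_variation c d f).
  rewrite -lee_fin fineK //; apply: le_trans (total_variation_ge f cx) _.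
  by rewrite (@total_variationD _ c d x f) // leeDl // total_variation_ge0.
have := lerB_dist (f x) (f c); lra.
Qed.

Lemma abs_contM c d f g : c <= d -> abs_cont c d f -> abs_cont c d g -> abs_cont c d (fun x => f x * g x).
Proof.
move=> cd acf acg e e0.
have [A A0 HA] := abs_cont_bounded _ _ _ cd acf.
have [B B0 HB] := abs_cont_bounded _ _ _ cd acg.
have eA : 0 < e / 2 / A by rewrite !divr_gt0.
have eB : 0 < e / 2 / B by rewrite !divr_gt0.
have [d1 d10 H1] := acf _ eB; have [d2 d20 H2] := acg _ eA.
exists (Num.min d1 d2) => [|s s1 s2]; first by rewrite lt_min d10.
rewrite lt_min => /andP[s3 s4].
have := H1 s s1 s2 s3; have := H2 s s1 s2 s4.
rewrite !ltr_pdivlMr // => h1 h2.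
have : osc (fun x => f x * g x) s <= osc f s * B + osc g s * A.
  rewrite /osc !mulr_suml -big_split /= big_seq [leRHS]big_seq.
  apply: ler_sum => p ps; have /andP[/andP[k1 k2] k3] := allP s1 p ps.
  rewrite (_ : _ - _ = (f p.2 - f p.1) * g p.2 + (g p.2 - g p.1) * f p.1); last ring.
  apply: le_trans (ler_normD _ _) _; rewrite !normrM; apply: lerD; apply: ler_wpM2l => //.
    by apply: HB; rewrite k3 (le_trans k1 k2).
  by apply: HA; rewrite k1 (le_trans k2 k3).
lra.
Qed.

Lemma ge_normc_Re (z : R[i]) : `|complex.Re z| <= Normc.normc z.
Proof.
by case: z => x y /=; rewrite -sqrtr_sqr ler_sqrt ?addr_ge0 ?sqr_ge0 // lerDl sqr_ge0.
Qed.

Lemma ge_normc_Im (z : R[i]) : `|complex.Im z| <= Normc.normc z.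
Proof.
by case: z => x y /=; rewrite -sqrtr_sqr ler_sqrt ?addr_ge0 ?sqr_ge0 // lerDr sqr_ge0.
Qed.

Lemma normc_le (z : R[i]) : Normc.normc z <= `|complex.Re z| + `|complex.Im z|.
Proof.
case: z => x y /=.
rewrite -[leRHS]ger0_norm ?addr_ge0 // -sqrtr_sqr ler_sqrt ?sqr_ge0 //.
rewrite sqrrD !real_normK ?num_real //.
have : 0 <= `|x| * `|y| by rewrite mulr_ge0.
by move: (`|x| * `|y|) => z; rewrite mulr2n; lra.
Qed.

(** Passage from families indexed by ordinals to lists of pairs, for [g] the real or imaginary part
    of [f]. *)
Lemma abs_continuous_abs_cont c d (f : R -> R[i]) (g : R -> R) : abs_continuous c d f ->
  (forall x y, `|g y - g x| <= Normc.normc (f y - f x)) -> abs_cont c d g.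
Proof.
move=> acf gf e e0; have [dl dl0 H] := acf _ e0; exists dl => // s s1 s2 s3.
pose u (k : 'I_(size s)) := (nth (0, 0) s k).1.
pose v (k : 'I_(size s)) := (nth (0, 0) s k).2.
have := H _ u v; rewrite /u /v => {}H.
apply: (@le_lt_trans _ _ (\sum_(k < size s) Normc.normc (f (v k) - f (u k)))).
  by rewrite /osc (big_nth (0, 0)) big_mkord; apply: ler_sum => k _; exact: gf.
apply: H.
- move=> k; have /andP[/andP[h1 h2] h3] := all_nthP (0, 0) s1 k (ltn_ord k).
  by split.
- have key (i j : 'I_(size s)) : (i < j)%N ->
      itv_sep (nth (0, 0) s i) (nth (0, 0) s j).
    by move=> ij; apply: (pairwiseP (0, 0) s2); rewrite // inE.
  move=> i j _ _ [x [/=]]; rewrite !in_itv /= => /andP[i1 i2] /andP[j1 j2].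
  apply/val_inj; case: (ltngtP i j) => // /key /orP[] h; exfalso; lra.
- by rewrite /tot_len (big_nth (0, 0)) big_mkord in s3.
Qed.

Lemma abs_continuous_Re c d (f : R -> R[i]) : abs_continuous c d f -> abs_cont c d (re_fun f).
Proof.
move=> H; apply: abs_continuous_abs_cont H _ => x y.
by rewrite /re_fun -raddfB; exact: ge_normc_Re.
Qed.

Lemma abs_continuous_Im c d (f : R -> R[i]) : abs_continuous c d f -> abs_cont c d (im_fun f).
Proof.
move=> H; apply: abs_continuous_abs_cont H _ => x y.
by rewrite /im_fun -raddfB; exact: ge_normc_Im.
Qed.

Lemma lipschitz_abs_continuous c d (f : R -> R[i]) K : 0 <= K ->
  (forall x y, c <= x -> x <= y -> y <= d -> `|re_fun f y - re_fun f x| <= K * (y - x)) ->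
  (forall x y, c <= x -> x <= y -> y <= d -> `|im_fun f y - im_fun f x| <= K * (y - x)) ->
  abs_continuous c d f.
Proof.
move=> K0 HR HI e e0; have K1 : 0 < 2 * K + 1 by lra.
exists (e / (2 * K + 1)) => [|n u v uv _]; first exact: divr_gt0.
rewrite ltr_pdivlMr // mulrC => s2; apply: le_lt_trans s2.
rewrite mulr_sumr; apply: ler_sum => k _; have [h1 [h2 h3]] := uv k.
apply: le_trans (normc_le _) _; rewrite !raddfB /=.
have := HR _ _ h1 h2 h3; have := HI _ _ h1 h2 h3; rewrite /re_fun /im_fun; nra.
Qed.

End FundamentalTheorem.

(** * Real functions on an interval *)

Section RealAnalysis.
Context {R : realType}.
Notation mu := (@lebesgue_measure R).
Implicit Types (a c d : R) (f g u : R -> R).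

Lemma is_derive_continuous f (x df : R) : is_derive x 1 f df -> {for x, continuous f}.
Proof. by move=> H; apply/differentiable_continuous/derivable1_diffP; exact: ex_derive. Qed.

Lemma is_derive_derive1 f (x df : R) : is_derive x 1 f df -> derive1 f x = df.
Proof. by move=> H; rewrite derive1E derive_val. Qed.

Lemma continuous_within c d g : (forall x, c <= x <= d -> {for x, continuous g}) ->
  {within `[c, d], continuous g}.
Proof.
by move=> cg; apply: continuous_in_subspaceT => x; rewrite inE /= in_itv /=; exact: cg.
Qed.

Lemma bounded_on c d g : c <= d -> {within `[c, d], continuous g} ->
  exists2 B : R, 0 <= B & forall x, c <= x <= d -> `|g x| <= B.
Proof.
move=> cd cg.
have cn : {within `[c, d], continuous (fun x => `|g x|)}.
  by move=> x; apply: continuous_comp; [exact: cg|exact: norm_continuous].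
have [m mcd H] := EVT_max cd cn.
by exists `|g m| => // x xcd; apply: H; rewrite in_itv.
Qed.

Lemma C1_lipschitz c d f f1 : c <= d ->
  (forall x, c <= x <= d -> is_derive x 1 f (f1 x)) -> {within `[c, d], continuous f1} ->
  exists2 K : R, 0 <= K & forall x y, c <= x -> x <= y -> y <= d -> `|f y - f x| <= K * (y - x).
Proof.
move=> cd H cf1; have [K K0 HK] := bounded_on _ _ _ cd cf1; exists K => // x y cx xy yd.
have [->|nxy] := eqVneq x y; first by rewrite !subrr normr0 mulr0.
have {nxy}xy : x < y by rewrite lt_neqAle nxy.
have [z|z|z] := @MVT _ f f1 _ _ xy.
- by rewrite in_itv /= => /andP[xz zy]; apply: H; apply/andP; split; lra.
- move: z; apply: continuous_within => z /andP[xz zy]; apply: (@is_derive_continuous _ _ (f1 z)).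
  by apply: H; apply/andP; split; lra.
- rewrite in_itv /= => /andP[xz zy] ->; rewrite normrM (ger0_norm (x := y - x)); last lra.
  apply: ler_wpM2r; first lra.
  by apply: HK; apply/andP; split; lra.
Qed.

Lemma C1_abs_cont c d f f1 : c <= d ->
  (forall x, c <= x <= d -> is_derive x 1 f (f1 x)) -> {within `[c, d], continuous f1} ->
  abs_cont c d f.
Proof. by move=> cd H cf; have [K K0] := C1_lipschitz _ _ _ _ cd H cf; exact: lipschitz_abs_cont. Qed.

Lemma abs_cont_continuous_within c d f : c <= d -> abs_cont c d f -> {within `[c, d], continuous f}.
Proof.
move=> cd acf; suff H : {in `[c, d]%classic, f =1 f \o clamp c d}.
  apply: (@subspace_eq_continuous _ _ _ (f \o clamp c d)) => [x xcd|].
    by rewrite -(H x xcd).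
  apply: continuous_subspaceT => x; apply/cvgrPdist_lt => e e0.
  have [dl dl0 Hdl] := acf _ e0.
  near=> y; have : `|x - y| < dl by near: y; exact: cvgr_dist_lt.
  have [xy|yx] := leP x y.
    rewrite distrC ger0_norm ?subr_ge0 // => ?; rewrite distrC.
    exact: (abs_cont_clamp_small _ _ _ _ _ _ _ cd Hdl).
  rewrite ger0_norm ?subr_ge0 ?(ltW yx) // => ?.
  by apply: (abs_cont_clamp_small _ _ _ _ _ _ _ cd Hdl) => //; exact: ltW.
by move=> x; rewrite inE /= in_itv /= => xcd; rewrite /= clamp_id.
Unshelve. all: by end_near. Qed.

Lemma continuous_integrable c d g : {within `[c, d], continuous g} ->
  mu.-integrable `[c, d] (EFin \o g).
Proof. by move=> cg; apply: continuous_compact_integrable => //; exact: segment_compact. Qed.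

Lemma integrable_mul c d g u : continuous g ->
  mu.-integrable `[c, d] (EFin \o u) -> mu.-integrable `[c, d] (EFin \o (fun x => g x * u x)).
Proof.
move=> cg iu; have [cd|dc] := leP c d; last first.
  by rewrite set_itv_ge ?bnd_simp -?ltNge //; exact: integrable_set0.
have m : measurable (`[c, d]%classic : set (measurableTypeR R)) by exact: measurable_itv.
have := @integrableMr _ _ _ mu _ m g _ _ _ iu.
apply.
  exact: measurable_funTS (continuous_measurable_fun cg).
have [B B0 HB] := bounded_on _ _ _ cd (continuous_subspaceT cg).
exists B; split; first exact: num_real.
by move=> M BM x /=; rewrite in_itv /= => xcd; apply: le_trans (HB _ xcd) (ltW BM).
Qed.

Lemma integrable_oo_cc c d f : c < d -> mu.-integrable `]c, d[ (EFin \o f) ->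
  mu.-integrable `[c, d] (EFin \o f).
Proof.
move=> cd iu; have mo : measurable (`]c, d[%classic : set (measurableTypeR R)) by exact: measurable_itv.
have mc : measurable (`[c, d]%classic : set (measurableTypeR R)) by exact: measurable_itv.
have m2 : measurable ([set c; d] : set (measurableTypeR R)) by apply: measurableU; exact: measurable_set1.
apply/(negligible_integrable m2 mc).
- apply/measurable_EFinP; apply: (@measurable_fun_itv_cc _ _ _ false true).
  by apply/measurable_EFinP; exact: measurable_int iu.
- apply/eqP; rewrite eq_le measure_ge0 andbT; apply: le_trans (measureU2 _ _ _) _ => //.
  rewrite -[X in (X + _)%E]/(mu [set c]) -[X in (_ + X)%E]/(mu [set d]).
  by rewrite !lebesgue_measure_set1 adde0.
- apply: integrableS iu => //; first exact: measurableD.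
  move=> x /= [] /=; rewrite !in_itv /= => /andP[cx xd] /not_orP[] /eqP xc /eqP xd'.
  by rewrite !lt_neqAle cx xd eq_sym xc xd'.
Qed.

(** On a bounded interval square integrability gives integrability, since |f| <= 1 + f^2. *)
Lemma integrable_sq c d f : measurable_fun `]c, d[ f ->
  (\int[mu]_(t in `]c, d[) (f t ^+ 2)%:E < +oo)%E -> c < d ->
  mu.-integrable `[c, d] (EFin \o f).
Proof.
move=> mf f2 cd; apply: integrable_oo_cc => //.
have mo : measurable (`]c, d[%classic : set (measurableTypeR R)) by exact: measurable_itv.
have i2 : mu.-integrable `]c, d[ (EFin \o (fun t => f t ^+ 2)).
  apply/integrableP; split; first by apply/measurable_EFinP; exact: measurable_funX.
  rewrite [ltLHS](_ : _ = \int[mu]_(t in `]c, d[) (f t ^+ 2)%:E)%E //.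
  by apply: eq_integral => t _ /=; rewrite ger0_norm ?sqr_ge0.
have i1 : mu.-integrable `]c, d[ (EFin \o (cst 1 : R -> R)).
  have ic : mu.-integrable `[c, d] (EFin \o (cst 1 : R -> R)).
    by apply: continuous_integrable; apply: continuous_subspaceT => x; exact: cvg_cst.
  by apply: integrableS ic => //; exact: subset_itv_oo_cc.
have i3 := integrableD mo i1 i2.
apply: (le_integrable mo _ _ i3); first exact/measurable_EFinP.
move=> x _ /=; rewrite lee_fin [leRHS]ger0_norm ?addr_ge0 ?sqr_ge0 //.
rewrite -(real_normK (num_real (f x))); have := normr_ge0 (f x).
by have := sqr_ge0 (`|f x| - 1); rewrite !expr2; nra.
Qed.

(** An improper integral: [F] computes it on each compact interval of an exhaustion, and monotone
    convergence passes to the union. *)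
Lemma ge0_integral_lty f F (c d : nat -> R) (A : set R) (B : R) :
  measurable A -> (forall x, 0 <= f x) ->
  (forall n, c n < d n) -> (forall n m, (n <= m)%N -> c m <= c n) ->
  (forall n m, (n <= m)%N -> d n <= d m) ->
  A `<=` \bigcup_n `[c n, d n]%classic ->
  (forall n x, c n <= x <= d n -> is_derive x 1 F (f x)) ->
  (forall n x, c n <= x <= d n -> {for x, continuous f}) ->
  (forall n, F (d n) - F (c n) <= B) ->
  measurable_fun A f /\ (\int[mu]_(t in A) (f t)%:E < +oo)%E.
Proof.
move=> mA f0 cd cni dnd sub dF cf FB.
have mI n : measurable (`[c n, d n]%classic : set (measurableTypeR R)) by exact: measurable_itv.
have cfn n : {within `[c n, d n], continuous f} by apply: continuous_within; exact: cf.
have mf n : measurable_fun `[c n, d n] f.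
  exact: subspace_continuous_measurable_fun.
have mU : measurable_fun (\bigcup_n `[c n, d n]%classic) f.
  by apply/measurable_fun_bigcup.
have mUU : measurable (\bigcup_n `[c n, d n]%classic : set (measurableTypeR R)).
  exact: bigcup_measurable.
split; first exact: measurable_funS mU.
apply: (@le_lt_trans _ _ B%:E); last by rewrite ltry.
apply: (@le_trans _ _ (\int[mu]_(t in \bigcup_n `[c n, d n]%classic) (f t)%:E)%E).
  apply: ge0_subset_integral => //; first exact/measurable_EFinP.
  by move=> x _; rewrite lee_fin.
have nd : nondecreasing_seq (fun n => `[c n, d n]%classic).
  move=> n m nm; rewrite subsetEset => x /=; rewrite !in_itv /= => /andP[h1 h2].
  by rewrite (le_trans (cni _ _ nm) h1) (le_trans h2 (dnd _ _ nm)).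
have cv : (\int[mu]_(x in `[c n, d n]) (f x)%:E @[n --> \oo] -->
    \int[mu]_(x in \bigcup_n `[c n, d n]%classic) (f x)%:E)%E.
  apply: ge0_nondecreasing_set_cvg_integral => // [n|n x _]; last by rewrite lee_fin.
  by apply/measurable_EFinP; exact: mf.
rewrite -(cvg_lim _ cv) //; apply: lime_le; first exact: cvgP cv.
apply: nearW => n; rewrite (@continuous_FTC2 _ f F) //.
- by rewrite -EFinB lee_fin.
- have cF x : c n <= x <= d n -> {for x, continuous F}.
    by move=> /dF; exact: is_derive_continuous.
  split.
  + move=> x; rewrite in_itv /= => /andP[h1 h2]; have [|//] := dF n x.
    by rewrite !ltW.
  + by apply: cvg_at_right_filter; apply: cF; rewrite lexx ltW.
  + by apply: cvg_at_left_filter; apply: cF; rewrite lexx ltW.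
- move=> x; rewrite in_itv /= => /andP[h1 h2]; apply: is_derive_derive1.
  by apply: (dF n); rewrite !ltW.
Qed.

(** A nonzero value would persist on a ball, whose measure is positive. *)
Lemma ae_eq_continuous c d f : (forall x, c < x < d -> {for x, continuous f}) ->
  {ae mu, forall x, c < x < d -> f x = 0} -> forall x, c < x < d -> f x = 0.
Proof.
move=> cf aef x xcd; apply/eqP/negPn/negP => fx0.
have fx : 0 < `|f x| by rewrite normr_gt0.
have : \forall y \near x, c < y < d /\ f y != 0.
  have : x \in `]c, d[ by rewrite in_itv.
  move=> /near_in_itvoo H; near=> y; split.
    by have : y \in `]c, d[ by near: y; exact: H.
  apply/eqP => fy0.
  have : `|f x - f y| < `|f x|.
    by near: y; move/cvgrPdist_lt: (cf _ xcd); apply.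
  by rewrite fy0 subr0 ltxx.
move=> /nbhs_ballP[e /= e0 He].
have [N [mN N0 NN]] := aef.
have sub : `]x - e, x + e[%classic `<=` N.
  move=> y /=; rewrite in_itv /= => /andP[h1 h2]; apply: NN => /= H.
  have [|ycd /eqP fy] := He y; last exact/fy/H.
  by rewrite /ball /= ltr_norml; apply/andP; split; lra.
have : (mu `](x - e)%R, (x + e)%R[%classic <= mu N)%E.
  by apply: le_measure; rewrite ?inE //; exact: measurable_itv.
rewrite N0 lebesgue_measure_itv; case: ifPn => [_|/negP []].
  by rewrite /= -EFinB lee_fin; lra.
by rewrite /= lte_fin; lra.
Unshelve. all: by end_near. Qed.

(** If the integral were 0, [f] would vanish almost everywhere, hence at [x] by continuity. *)
Lemma Rintegral_gt0 c d f x : c < x < d -> continuous f ->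
  (forall y, c <= y <= d -> 0 <= f y) -> 0 < f x -> 0 < \int[mu]_(y in `[c, d]) f y.
Proof.
move=> xcd cf f0 fx; rewrite lt_neqAle; apply/andP; split; last first.
  by apply: Rintegral_ge0 => y /=; rewrite in_itv; exact: f0.
rewrite eq_sym; apply/eqP => I0.
have mc : measurable (`[c, d]%classic : set (measurableTypeR R)) by exact: measurable_itv.
have intf := continuous_integrable _ _ _ (continuous_subspaceT (A := `[c, d]%classic) cf).
have E0 : (\int[mu]_(y in `[c, d]) `|(f y)%:E| = 0)%E.
  have := integrable_fin_num mc intf => /fineK; rewrite -[fine _]/(Rintegral _ _ _) I0.
  move=> I; transitivity (\int[mu]_(y in `[c, d]) (f y)%:E)%E; last exact: esym I.
  apply: eq_integral => y; rewrite inE /= in_itv => ycd.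
  by rewrite ger0_norm //; exact: f0.
have /(ae_eq_integral_abs _ mc) := E0.
move=> /(_ (measurable_int _ intf)) H.
suff : f x = 0 by lra.
apply: (@ae_eq_continuous c d) => // [y _|]; first exact: cf.
have {}H : {ae mu, forall y, `[c, d]%classic y -> (f y)%:E = 0%E} := H.
move: H; apply: filterS; first exact: (ae_filter_ringOfSetsType mu).
move=> y Hy /andP[h1 h2]; have /= := Hy _; rewrite in_itv /= !ltW // => /(_ isT) [].
by [].
Qed.

End RealAnalysis.

(** * Green's identity and boundary values *)

Section Green.
Context {R : realType}.
Notation mu := (@lebesgue_measure R).
Variable a : R.
Hypothesis a_gt0 : (0 : R) < a.
Implicit Types (u k : R -> R).

(* [pw] is the weight p of the operator L x = - (p x')' + t^2 x, [rprolate] is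
   L with Rocq's total derivative, and [prolate_expr k k1 k2] is L k expressed
   through the derivatives k1 and k2 of k. *)
Definition pw (s : R) : R := 1 - s ^+ 2 / a ^+ 2.

Definition rprolate u (t : R) : R :=
  - derive1 (fun s => pw s * derive1 u s) t + t ^+ 2 * u t.

Definition prolate_expr (k k1 k2 : R -> R) (t : R) : R :=
  - (pw t * k2 t - 2 * t / a ^+ 2 * k1 t) + t ^+ 2 * k t.

(** What the real and imaginary parts of a member of [dom_Lmax] satisfy, with square integrability
    relaxed to integrability. *)
Definition regular u : Prop :=
  [/\ forall t : R, - a < t < a -> derivable u t 1,
      forall c d : R, - a < c -> c <= d -> d < a -> abs_cont c d (derive1 u),
      mu.-integrable `[- a, a] (EFin \o u) &
      mu.-integrable `[- a, a] (EFin \o rprolate u)].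

(** The derivatives are carried as functions so that [prolate_expr] and [wronskian] need no
    derivative of a test function. *)
Definition C2 (k k1 k2 : R -> R) : Prop :=
  [/\ forall t : R, is_derive t 1 k (k1 t),
      forall t : R, is_derive t 1 k1 (k2 t) & continuous k2].

Lemma is_derive_pw (t : R) : is_derive t 1 pw (- (2 * t / a ^+ 2)).
Proof.
rewrite /pw; apply: is_derive_eq.
by rewrite /GRing.scale /=; field; rewrite gt_eqF.
Qed.

Lemma continuous_pw : continuous pw.
Proof. by move=> t; apply: is_derive_continuous (is_derive_pw t). Qed.

Lemma C2_cont k k1 k2 : C2 k k1 k2 -> continuous k /\ continuous k1.
Proof.
by case=> h1 h2 _; split=> t; [apply: is_derive_continuous (h1 t)|apply: is_derive_continuous (h2 t)].
Qed.

Lemma continuous_prolate_expr k k1 k2 : C2 k k1 k2 -> continuous (prolate_expr k k1 k2).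
Proof.
move=> kk; have [ck ck1] := C2_cont _ _ _ kk; case: kk => _ _ ck2 t.
have c1 : {for t, continuous (fun t : R => 2 * t / a ^+ 2)}.
  apply: (@is_derive_continuous _ _ _ (2 / a ^+ 2)); apply: is_derive_eq.
  by rewrite /GRing.scale /=; field; rewrite gt_eqF.
have c2 : {for t, continuous (fun t : R => t ^+ 2)}.
  by apply: (@is_derive_continuous _ _ _ _); apply: is_deriveX.
rewrite /prolate_expr; apply: cvgD; last by apply: cvgM => //; exact: ck.
apply: cvgN; apply: cvgB; apply: cvgM => //; [exact: continuous_pw|exact: ck2|exact: ck1].
Qed.

Section Wronskian.
Variables (u k k1 k2 : R -> R).
Hypotheses (ru : regular u) (ck : C2 k k1 k2).

Definition wronskian (t : R) : R := pw t * (k t * derive1 u t - k1 t * u t).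

(** By Lagrange's identity this is the derivative of [wronskian]; the two terms t^2 k u cancel. *)
Definition green_density (t : R) : R :=
  prolate_expr k k1 k2 t * u t - k t * rprolate u t.

Lemma green_density_integrable : mu.-integrable `[- a, a] (EFin \o green_density).
Proof.
case: ru => _ _ iu iLu; have [ckk _] := C2_cont _ _ _ ck.
have i1 := integrable_mul _ _ _ _ (continuous_prolate_expr _ _ _ ck) iu.
have i2 := integrable_mul _ _ _ _ ckk iLu.
have m : measurable (`[- a, a]%classic : set (measurableTypeR R)) by exact: measurable_itv.
exact: (integrableB m i1 i2).
Qed.

Lemma is_derive_wronskian (x : R) : - a < x < a -> derivable (derive1 u) x 1 ->
  derive1 wronskian x = green_density x.
Proof.
move=> xa D; have [hk hk1 _] := ck; case: ru => hu _ _ _.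
have dk := hk x; have dk1 := hk1 x; have dp := is_derive_pw x.
have du : is_derive x 1 u (derive1 u x) by rewrite derive1E; apply/derivableP/hu.
have du1 : is_derive x 1 (derive1 u) (derive1 (derive1 u) x).
  by rewrite [derive1 (derive1 u) x]derive1E; exact/derivableP.
have E1 : derive1 (fun s => pw s * derive1 u s) x =
   pw x * derive1 (derive1 u) x - 2 * x / a ^+ 2 * derive1 u x.
  by apply: is_derive_derive1; apply: is_derive_eq; rewrite /GRing.scale /=; ring.
rewrite /green_density /rprolate E1 /prolate_expr.
by apply: is_derive_derive1; apply: is_derive_eq; rewrite /GRing.scale /=; ring.
Qed.

(** The Wronskian inherits absolute continuity from [derive1 u], which has it on compact
    subintervals only; hence the strict inequalities at both ends. *)
Lemma green_itv (c d : R) : - a < c -> c <= d -> d < a ->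
  wronskian d - wronskian c = \int[mu]_(x in `[c, d]) green_density x.
Proof.
move=> mac cd da; have [hk hk1 hk2] := ck; have [hu hac iu iLu] := ru.
have [ck0 ck1] := C2_cont _ _ _ ck.
have acu1 := hac _ _ mac cd da.
have acu : @abs_cont R c d u.
  apply: (C1_abs_cont _ _ _ (derive1 u) cd) => [x /andP[cx xd]|].
    by rewrite derive1E; apply/derivableP/hu/andP; split; lra.
  exact: abs_cont_continuous_within.
have ack : @abs_cont R c d k by apply: (C1_abs_cont _ _ _ k1 cd) => //; exact: continuous_subspaceT.
have ack1 : @abs_cont R c d k1 by apply: (C1_abs_cont _ _ _ k2 cd) => //; exact: continuous_subspaceT.
have acp : @abs_cont R c d pw.
  apply: (C1_abs_cont _ _ _ (fun t => - (2 * t / a ^+ 2)) cd) => [x _|]; first exact: is_derive_pw.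
  apply: continuous_subspaceT => t.
  apply: (@is_derive_continuous _ _ _ (- (2 / a ^+ 2))); apply: is_derive_eq.
  by rewrite /GRing.scale /=; field; rewrite gt_eqF.
apply: abs_cont_integral => //.
- apply: abs_contM => //; apply: abs_contB; exact: abs_contM.
- apply: integrableS green_density_integrable => //; try exact: measurable_itv.
  by move=> x; rewrite /= !in_itv /= => /andP[cx xd]; apply/andP; split; lra.
have [h [_ _ aeh]] := abs_cont_ae_derivable _ _ _ cd acu1.
move: aeh; apply: filterS; first exact: (ae_filter_ringOfSetsType mu).
move=> x H xcd _; have [D _] := H xcd; apply: is_derive_wronskian => //.
by case/andP: xcd => cx xd; apply/andP; split; lra.
Qed.

(** The limit exists because the density is integrable up to the endpoint. *)
Lemma wronskian_cvg_right :
  wronskian x @[x --> a^'-] --> wronskian 0 + \int[mu]_(x in `[0, a]) green_density x.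
Proof.
have iw := green_density_integrable.
have i0 : mu.-integrable `[0, a] (EFin \o green_density).
  apply: integrableS iw => //; try exact: measurable_itv.
  by move=> x; rewrite /= !in_itv /= => /andP[cx xd]; apply/andP; split; lra.
have cv := parameterized_integral_cvg_at_left a_gt0 i0.
have : wronskian 0 + parameterized_integral mu 0 x green_density @[x --> a^'-] -->
   wronskian 0 + parameterized_integral mu 0 a green_density.
  by apply: cvgD => //; exact: cvg_cst.
apply: cvg_trans; apply: near_eq_cvg; near=> x.
rewrite /parameterized_integral -green_itv; [by rewrite addrC subrK|by rewrite oppr_lt0| |].
  by near: x; exact: nbhs_left_ge.
by near: x; exact: nbhs_left_lt.
Unshelve. all: by end_near. Qed.

Lemma wronskian_cvg_left :
  wronskian x @[x --> (- a)^'+] --> wronskian 0 - \int[mu]_(x in `[- a, 0]) green_density x.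
Proof.
have iw := green_density_integrable.
have i0 : mu.-integrable `[- a, 0] (EFin \o green_density).
  apply: integrableS iw => //; try exact: measurable_itv.
  by move=> x; rewrite /= !in_itv /= => /andP[cx xd]; apply/andP; split; lra.
have na0 : - a < 0 by rewrite oppr_lt0.
have cv := cvg_at_right_filter (parameterized_integral_cvg_left na0 i0).
have : wronskian 0 - (parameterized_integral mu (- a) 0 green_density
      - parameterized_integral mu (- a) x green_density) @[x --> (- a)^'+] -->
   wronskian 0 - (parameterized_integral mu (- a) 0 green_density - 0).
  by apply: cvgB; [exact: cvg_cst|apply: cvgB => //; exact: cvg_cst].
rewrite subr0; apply: cvg_trans; apply: near_eq_cvg; near=> x.
have ax : - a < x by near: x; exact: nbhs_right_gt.
have x0 : x <= 0 by near: x; exact: nbhs_right_le.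
rewrite /parameterized_integral Rintegral_itvB ?bnd_simp ?(ltW ax) //.
rewrite Rintegral_itv_obnd_cbnd; last first.
  apply: integrableS i0 => //; try exact: measurable_itv.
  by move=> y; rewrite /= !in_itv /= => /andP[cx xd]; apply/andP; split; lra.
by rewrite -green_itv //; ring.
Unshelve. all: by end_near. Qed.

Lemma green_limits (l r : R) : wronskian x @[x --> (- a)^'+] --> l ->
  wronskian x @[x --> a^'-] --> r -> \int[mu]_(x in `[- a, a]) green_density x = r - l.
Proof.
move=> hl hr.
have El := cvg_unique (@norm_hausdorff _ R) hl wronskian_cvg_left.
have Er := cvg_unique (@norm_hausdorff _ R) hr wronskian_cvg_right.
have iw := green_density_integrable.
have := @Rintegral_itvB _ green_density (BLeft (- a)) (BRight a) 0 iw.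
rewrite !bnd_simp => E; have {E} := E _ _; rewrite oppr_le0 ltW // => /(_ isT isT).
rewrite Rintegral_itv_obnd_cbnd; last first.
  apply: integrableS iw => //; try exact: measurable_itv.
  by move=> y; rewrite /= !in_itv /= => /andP[cx xd]; apply/andP; split; lra.
have -> : r = wronskian 0 + \int[mu]_(x in `[0, a]) green_density x by exact: Er.
have -> : l = wronskian 0 - \int[mu]_(x in `[- a, 0]) green_density x by exact: El.
lra.
Qed.

End Wronskian.
End Green.

(** * Logarithmic growth and boundary values at the endpoints *)

Section Boundary.
Context {R : realType}.
Notation mu := (@lebesgue_measure R).

(** With s = sqrt x one has x ln x = 2 s (s ln s), and ln (1/s) <= 1/s bounds s |ln s| by 1. *)
Lemma xlnx_le (x : R) : 0 < x -> x <= 1 -> `|x * ln x| <= 2 * Num.sqrt x.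
Proof.
move=> x0 x1; have s0 : 0 < Num.sqrt x by rewrite sqrtr_gt0.
have s1 : Num.sqrt x <= 1 by rewrite -sqrtr1 ler_sqrt.
have xE : x = Num.sqrt x * Num.sqrt x by rewrite -expr2 sqr_sqrtr // ltW.
have si0 : 0 < (Num.sqrt x)^-1 by rewrite invr_gt0.
have lni := ln_sublinear si0; rewrite lnV ?posrE // in lni.
have lnx : ln x = 2 * ln (Num.sqrt x) by rewrite {1}xE lnM ?posrE //; ring.
have ln0 : ln (Num.sqrt x) <= 0 by rewrite ln_le0.
rewrite normrM (ger0_norm (ltW x0)) ler0_norm; last by rewrite lnx; lra.
rewrite lnx {1}xE.
have : Num.sqrt x * - ln (Num.sqrt x) <= 1.
  rewrite -ler_pdivlMl // mulr1; exact: ltW.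
move: s0; set s := Num.sqrt x; set l := ln s => s0 h; nra.
Qed.

Lemma xlnx_cvg_left (a : R) : (a - t) * ln (a - t) @[t --> a^'-] --> (0 : R).
Proof.
apply: norm_cvg0.
apply: (@squeeze_cvgr _ _ _ _ (cst 0) (fun t => 2 * Num.sqrt (a - t))); last 2 first.
- exact: cvg_cst.
- have : 2 * Num.sqrt (a - t) @[t --> a] --> 2 * Num.sqrt (a - a).
    apply: cvgM; first exact: cvg_cst.
    apply: (@continuous_comp _ _ _ (fun t => a - t) Num.sqrt a); last exact: sqrt_continuous.
    by apply: cvgB; [exact: cvg_cst|exact: cvg_id].
  by rewrite subrr sqrtr0 mulr0; exact: cvg_at_left_filter.
near=> t; rewrite normr_ge0 /=; apply: xlnx_le.
  by rewrite subr_gt0; near: t; exact: nbhs_left_lt.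
by apply: ltW; near: t; exact: nbhs_left_ltBl.
Unshelve. all: by end_near. Qed.

Lemma xlnx_cvg_right (b : R) : (t - b) * ln (t - b) @[t --> b^'+] --> (0 : R).
Proof.
have := xlnx_cvg_left (- b); move/cvg_at_leftNP; rewrite opprK.
rewrite (_ : _ \o _ = (fun t => (t - b) * ln (t - b))) //.
by apply/funext => t /=; rewrite opprK addrC.
Qed.

(* [u] grows at most like [ln (a - t)], by Cauchy's mean value theorem. *)
Lemma log_growth_left (u u1 : R -> R) (a e M : R) : 0 < e ->
  (forall x : R, a - e < x < a -> is_derive x 1 u (u1 x) /\ `|(a - x) * u1 x| <= M) ->
  (a - t) * u t @[t --> a^'-] --> (0 : R).
Proof.
move=> e0 H; pose t0 := a - e / 2; have t0a : t0 < a by rewrite /t0; lra.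
pose L t := ln (a - t).
have dL (x : R) : x < a -> is_derive x 1 L (- (a - x)^-1).
  move=> xa; have := is_derive1_ln (x := a - x).
  rewrite subr_gt0 => /(_ xa) h.
  have h2 : is_derive x 1 (fun y : R => a - y) (-1).
    by apply: is_derive_eq; rewrite add0r mul1r.
  by have := @is_derive1_comp _ _ (fun y : R => a - y) x _ _ h h2; rewrite mulrN1.
have bound (t : R) : t0 < t -> t < a -> `|u t| <= `|u t0| + M * (`|L t| + `|L t0|).
  move=> t0t ta.
  have H' (x : R) : t0 <= x <= t -> is_derive x 1 u (u1 x) /\ `|(a - x) * u1 x| <= M.
    by move=> /andP[h1 h2]; apply: H; apply/andP; split; rewrite /t0 in h1; lra.
  have [||x|x|x|x] := @cauchy_MVT _ u u1 L (fun x => - (a - x)^-1) _ _ t0t.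
  - apply: continuous_within => x /H' [h _]; exact: is_derive_continuous h.
  - apply: continuous_within => x /andP[_ xt].
    by apply: is_derive_continuous (dL x _); lra.
  - by rewrite in_itv /= => /andP[h1 h2]; have [|//] := H' x; rewrite !ltW.
  - by rewrite in_itv /= => /andP[h1 h2]; apply: dL; lra.
  - by rewrite in_itv /= => /andP[h1 h2]; rewrite oppr_eq0 invr_eq0 subr_eq0 gt_eqF //; lra.
  rewrite in_itv /= => /andP[h1 h2] E.
  have [_ hM] : is_derive x 1 u (u1 x) /\ `|(a - x) * u1 x| <= M.
    by apply: H'; rewrite !ltW.
  have LL : L t - L t0 != 0.
    rewrite subr_eq0 /L; apply/eqP => /ln_inj; rewrite !posrE => hh.
    have : a - t = a - t0 by apply: hh; lra.
    lra.
  have {}E : u t - u t0 = - ((a - x) * u1 x) * (L t - L t0).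
    apply: (mulIf (invr_neq0 LL)); rewrite -E mulrK ?unitfE // invrN invrK.
    by rewrite mulrN mulrC.
  have h3 : `|u t - u t0| <= M * `|L t - L t0|.
    by rewrite E normrM normrN; apply: ler_wpM2r.
  have h4 : `|L t - L t0| <= `|L t| + `|L t0| by exact: ler_normB.
  have M0 : 0 <= M by apply: le_trans hM.
  have h5 : `|u t| <= `|u t - u t0| + `|u t0|.
    by rewrite -{1}(subrK (u t0) (u t)); exact: ler_normD.
  have h6 := ler_wpM2l M0 h4; lra.
apply: norm_cvg0.
apply: (@squeeze_cvgr _ _ _ _ (cst 0) (fun t => (a - t) * (`|u t0| + M * `|L t0|) +
   M * `|(a - t) * L t|)); last 2 first.
- exact: cvg_cst.
- rewrite -[X in _ --> X]addr0; apply: cvgD.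
    rewrite -[X in _ --> X](mul0r (`|u t0| + M * `|L t0|)); apply: cvgM; last exact: cvg_cst.
    rewrite -[X in _ --> X](subrr a); apply: cvg_at_left_filter.
    by apply: cvgB; [exact: cvg_cst|exact: cvg_id].
  rewrite -[X in _ --> X](mulr0 M); apply: cvgM; first exact: cvg_cst.
  by rewrite -[X in _ --> X](@normr0 _ R); apply: cvg_norm; exact: xlnx_cvg_left.
near=> t; have ta : t < a by near: t; exact: nbhs_left_lt.
have t0t : t0 < t by near: t; exact: nbhs_left_gt.
rewrite normr_ge0 /= !normrM (ger0_norm (x := a - t)); last lra.
have := bound t t0t ta; move: (`|u t|) (`|u t0|) (`|L t|) (`|L t0|) => A B C D h.
have at0 : 0 <= a - t by lra.
have := ler_wpM2l at0 h; lra.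
Unshelve. all: by end_near. Qed.

Lemma log_growth_right (u u1 : R -> R) (b e M : R) : 0 < e ->
  (forall x : R, b < x < b + e -> is_derive x 1 u (u1 x) /\ `|(x - b) * u1 x| <= M) ->
  (t - b) * u t @[t --> b^'+] --> (0 : R).
Proof.
move=> e0 H.
have := @log_growth_left (fun t => u (- t)) (fun t => - u1 (- t)) (- b) e M e0.
move=> /(_ _)/cvg_at_leftNP; rewrite opprK.
rewrite (_ : _ \o _ = (fun t => (t - b) * u t)); last first.
  by apply/funext => t /=; rewrite !opprK addrC.
apply => x /andP[h1 h2].
have [|h h'] := H (- x); first by apply/andP; split; lra.
split.
  have hN : is_derive x 1 (fun y : R => - y) (-1) by apply: is_deriveNid.
  by have := is_derive1_comp h hN; rewrite mulrN1.
by rewrite (_ : (- b - x) * _ = - ((- x - b) * u1 (- x))) ?normrN //; ring.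
Qed.

Variable a : R.
Hypothesis a_gt0 : (0 : R) < a.
Implicit Types u k : R -> R.

(** The factor comes from the weight: p behaves like -(2/a) (t - a) at a and like (2/a) (t + a) at
    -a, so p u' tends to -(2/a) [br] and (2/a) [bl]. *)
Lemma regular_boundary u : regular a u -> exists bl br : R, [/\
  (t + a) * derive1 u t @[t --> (- a)^'+] --> bl,
  (t - a) * derive1 u t @[t --> a^'-] --> br &
  forall k k1 k2, C2 k k1 k2 ->
    \int[mu]_(x in `[- a, a]) green_density a u k k1 k2 x =
    - (2 / a) * (k a * br + k (- a) * bl)].
Proof.
move=> ru; have [hu _ _ _] := ru; have a0 : a != 0 by rewrite gt_eqF.
(* For the test function 1 the Wronskian is p u' alone, so its limits show that the boundary values
   exist. *)
have c1 : C2 (cst 1 : R -> R) (cst 0) (cst 0).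
  by split => [t|t|t]; [exact: is_derive_cst|exact: is_derive_cst|exact: cvg_cst].
have du x : - a < x < a -> is_derive x 1 u (derive1 u x).
  by move=> xa; rewrite derive1E; apply/derivableP/hu.
have := wronskian_cvg_left a a_gt0 u _ _ _ ru c1; set ml := (X in _ --> X) => hl.
have := wronskian_cvg_right a a_gt0 u _ _ _ ru c1; set mr := (X in _ --> X) => hr.
have WE t : wronskian a u (cst 1) (cst 0) t = pw a t * derive1 u t.
  by rewrite /wronskian mul1r mul0r subr0.
have {}hl : pw a t * derive1 u t @[t --> (- a)^'+] --> ml.
  by move: hl; under eq_fun do rewrite WE.
have {}hr : pw a t * derive1 u t @[t --> a^'-] --> mr.
  by move: hr; under eq_fun do rewrite WE.
have a2 : a + a != 0 by rewrite gt_eqF // addr_gt0.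
have pwE t : pw a t = (a - t) * (a + t) / a ^+ 2 by rewrite /pw; field.
have cr : - (a ^+ 2 / (a + t)) @[t --> a^'-] --> - (a / 2).
  rewrite (_ : a / 2 = a ^+ 2 / (a + a)); last by field; rewrite ?a0 ?a2.
  apply: cvg_at_left_filter; apply: cvgN; apply: cvgM; first exact: cvg_cst.
  apply: cvgV; first exact: a2.
  by apply: cvgD; [exact: cvg_cst|exact: cvg_id].
have cl : (a ^+ 2 / (a - t)) @[t --> (- a)^'+] --> a / 2.
  rewrite (_ : a / 2 = a ^+ 2 / (a - - a)); last by rewrite opprK; field; rewrite ?a0 ?a2.
  apply: cvg_at_right_filter; apply: cvgM; first exact: cvg_cst.
  apply: cvgV; first by rewrite opprK.
  by apply: cvgB; [exact: cvg_cst|exact: cvg_id].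
have hbr : (t - a) * derive1 u t @[t --> a^'-] --> - (a / 2) * mr.
  apply: cvg_trans (cvgM cr hr); apply: near_eq_cvg; near=> t.
  have t1 : 0 < t by near: t; exact: nbhs_left_gt.
  by rewrite /= pwE; field; rewrite a0 gt_eqF // addr_gt0.
have hbl : (t + a) * derive1 u t @[t --> (- a)^'+] --> (a / 2) * ml.
  apply: cvg_trans (cvgM cl hl); apply: near_eq_cvg; near=> t.
  have t1 : t < 0 by near: t; apply: nbhs_right_lt; rewrite oppr_lt0.
  have at0 : a - t != 0 by rewrite subr_eq0 gt_eqF // (lt_trans t1).
  by rewrite /= pwE; field; rewrite a0 at0.
have na : - a < a by rewrite (lt_trans _ a_gt0) // oppr_lt0.
(* Convergence of (t - a) u' bounds it near the endpoint, which is the hypothesis of the logarithmic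
   growth estimate. *)
have hur : pw a t * u t @[t --> a^'-] --> (0 : R).
  have h : (a - t) * u t @[t --> a^'-] --> (0 : R).
    have : \forall t \near a^'-, - a < t /\ `|(t - a) * derive1 u t| <= `|- (a / 2) * mr| + 1.
      near=> t; split; first by near: t; exact: nbhs_left_gt.
      have : `|- (a / 2) * mr - (t - a) * derive1 u t| < 1.
        by near: t; move/cvgrPdist_lt: hbr; apply.
      have := lerB_dist ((t - a) * derive1 u t) (- (a / 2) * mr); rewrite distrC; lra.
    move=> /nbhs_ballP[e /= e0 He].
    apply: (@log_growth_left u (derive1 u) a e (`|- (a / 2) * mr| + 1) e0) => x /andP[h1 h2].
    have [||h3 h4] := He x => //.
      by rewrite /ball /= ger0_norm; lra.
    by split; [apply: du; rewrite h3|rewrite -normrN -mulNr opprB].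
  have c2 : (a + t) / a ^+ 2 @[t --> a^'-] --> (a + a) / a ^+ 2.
    apply: cvg_at_left_filter; apply: cvgM; last exact: cvg_cst.
    by apply: cvgD; [exact: cvg_cst|exact: cvg_id].
  rewrite -[X in _ --> X](mulr0 ((a + a) / a ^+ 2)); apply: cvg_trans (cvgM c2 h); apply: near_eq_cvg.
  by apply: nearW => t /=; rewrite pwE; field.
have hul : pw a t * u t @[t --> (- a)^'+] --> (0 : R).
  have h : (t - - a) * u t @[t --> (- a)^'+] --> (0 : R).
    have : \forall t \near (- a)^'+, t < a /\ `|(t + a) * derive1 u t| <= `|(a / 2) * ml| + 1.
      near=> t; split; first by near: t; exact: nbhs_right_lt.
      have : `|(a / 2) * ml - (t + a) * derive1 u t| < 1.
        by near: t; move/cvgrPdist_lt: hbl; apply.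
      have := lerB_dist ((t + a) * derive1 u t) ((a / 2) * ml); rewrite distrC; lra.
    move=> /nbhs_ballP[e /= e0 He].
    apply: (@log_growth_right u (derive1 u) (- a) e (`|(a / 2) * ml| + 1) e0) => x /andP[h1 h2].
    have [||h3 h4] := He x => //.
      by rewrite /ball /= ler0_norm; lra.
    by split; [apply: du; rewrite h1|rewrite opprK].
  have c2 : (a - t) / a ^+ 2 @[t --> (- a)^'+] --> (a - - a) / a ^+ 2.
    apply: cvg_at_right_filter; apply: cvgM; last exact: cvg_cst.
    by apply: cvgB; [exact: cvg_cst|exact: cvg_id].
  rewrite -[X in _ --> X](mulr0 ((a - - a) / a ^+ 2)); apply: cvg_trans (cvgM c2 h); apply: near_eq_cvg.
  by apply: nearW => t /=; rewrite pwE; field.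
exists (a / 2 * ml), (- (a / 2) * mr); split => // k k1 k2 kk.
have [ck ck1] := C2_cont _ _ _ kk.
(* The factor of [k1] tends to 0, so only the limits of p u' survive at the endpoints. *)
have WkE t : wronskian a u k k1 t = k t * (pw a t * derive1 u t) - k1 t * (pw a t * u t).
  by rewrite /wronskian; ring.
rewrite (@green_limits _ a a_gt0 u k k1 k2 ru kk (k (- a) * ml) (k a * mr)).
- by field.
- rewrite (funext WkE).
  rewrite -[X in _ --> X]subr0 -[X in _ - X](mulr0 (k1 (- a))); apply: cvgB; apply: cvgM => //.
    by apply: cvg_at_right_filter; exact: ck.
  by apply: cvg_at_right_filter; exact: ck1.
- rewrite (funext WkE).
  rewrite -[X in _ --> X]subr0 -[X in _ - X](mulr0 (k1 a)); apply: cvgB; apply: cvgM => //.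
    by apply: cvg_at_left_filter; exact: ck.
  by apply: cvg_at_left_filter; exact: ck1.
Unshelve. all: by end_near. Qed.

End Boundary.

(** * Functions with logarithmic singularities at the endpoints *)

Section LogClass.
Context {R : realType}.
Notation mu := (@lebesgue_measure R).
Variable a : R.
Hypothesis a_gt0 : (0 : R) < a.

Lemma is_derive_addl (b t : R) : is_derive t 1 (fun s : R => b + s) 1.
Proof. by rewrite -[X in is_derive _ _ _ X]add0r; exact: is_deriveD. Qed.

Lemma is_derive_subl (b t : R) : is_derive t 1 (fun s : R => b - s) (-1).
Proof. by rewrite -[X in is_derive _ _ _ X]add0r; exact: is_deriveB. Qed.

Lemma is_derive_ln_add (t : R) : - a < t -> is_derive t 1 (fun s => ln (a + s)) (a + t)^-1.
Proof.
move=> at0; have h0 : 0 < a + t by lra.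
have h1 := is_derive_addl a t.
by have := @is_derive1_comp _ _ (fun s : R => a + s) t _ _ (is_derive1_ln h0) h1; rewrite mulr1.
Qed.

Lemma is_derive_ln_sub (t : R) : t < a -> is_derive t 1 (fun s => ln (a - s)) (- (a - t)^-1).
Proof.
move=> ta; have h0 : 0 < a - t by lra.
have h1 := is_derive_subl a t.
by have := @is_derive1_comp _ _ (fun s : R => a - s) t _ _ (is_derive1_ln h0) h1; rewrite mulrN1.
Qed.

Lemma ge0_integrable_lty (D : set (measurableTypeR R)) (f : R -> R) : measurable D ->
  measurable_fun D f -> (forall x, 0 <= f x) ->
  (\int[mu]_(t in D) (f t)%:E < +oo)%E <-> mu.-integrable D (EFin \o f).
Proof.
move=> mD mf f0.
have E : (\int[mu]_(t in D) `|(EFin \o f) t| = \int[mu]_(t in D) (f t)%:E)%E.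
  by apply: eq_integral => t _ /=; rewrite ger0_norm.
split=> [h|/integrableP[_]]; last by rewrite E.
by apply/integrableP; split; [exact/measurable_EFinP|rewrite E].
Qed.

(* An antiderivative of [ln ^ 2]. *)
Let Phi (s : R) : R := s * ((ln s - 1) ^+ 2 + 1).

Let Phi_ge0 (s : R) : 0 < s -> 0 <= Phi s.
Proof. by move=> s0; apply: mulr_ge0; [exact: ltW|rewrite addr_ge0 ?sqr_ge0]. Qed.

Let is_derive_Phi (s : R) : 0 < s -> is_derive s 1 Phi (ln s ^+ 2).
Proof.
move=> s0; have h := is_derive1_ln s0; rewrite /Phi; apply: is_derive_eq.
by rewrite /GRing.scale /=; field; rewrite gt_eqF.
Qed.

(** Distance kept from the singular endpoint in the exhaustion; being at most [a], it leaves a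
    nondegenerate interval. *)
Let eps (n : nat) : R := a / n.+1%:R.

Let eps_gt0 n : 0 < eps n.
Proof. by rewrite divr_gt0. Qed.

Let eps_le n : eps n <= a.
Proof. by rewrite ler_pdivrMr // -[leLHS]mulr1 ler_pM2l // ler1n. Qed.

Let eps_mono n m : (n <= m)%N -> eps m <= eps n.
Proof.
move=> nm; apply: ler_wpM2l; first exact: ltW.
by rewrite lef_pV2 ?posrE // ler_nat.
Qed.

Let eps_small (x : R) : 0 < x -> exists n, eps n <= x.
Proof.
move=> x0; exists (Num.truncn (a / x)); rewrite ler_pdivrMr // mulrC -ler_pdivrMr //.
exact/ltW/truncnS_gt.
Qed.

Lemma ln_sub_sq_integrable :
  mu.-integrable `]- a, a[ (EFin \o (fun t : R => ln (a - t) ^+ 2)).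
Proof.
have m : measurable (`]- a, a[%classic : set (measurableTypeR R)) by exact: measurable_itv.
have na : - a < a by rewrite (lt_trans _ a_gt0) // oppr_lt0.
have dF n (x : R) : - a <= x <= a - eps n ->
    is_derive x 1 (fun t => - Phi (a - t)) (ln (a - x) ^+ 2).
  move=> /andP[h1 h2]; have e0 := eps_gt0 n; have h3 : 0 < a - x by lra.
  have h4 := is_derive_subl a x.
  have h5 := @is_derive1_comp _ _ (fun s : R => a - s) x _ _ (is_derive_Phi _ h3) h4.
  by have := is_deriveN h5; rewrite mulrN1 opprK.
have [||||||n|mf If] := @ge0_integral_lty R (fun t => ln (a - t) ^+ 2)
  (fun t => - Phi (a - t)) (fun _ => - a) (fun n => a - eps n) `]- a, a[%classic (Phi (a - - a)) m.
- by move=> x; exact: sqr_ge0.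
- by move=> n; have := eps_le n; have := a_gt0; lra.
- by [].
- by move=> n k /eps_mono; lra.
- move=> x /=; rewrite in_itv /= => /andP[h1 h2].
  have [|n hn] := eps_small (a - x); first by rewrite subr_gt0.
  by exists n => //=; rewrite in_itv /= ltW //=; lra.
- move=> n x /andP[h1 h2]; have e0 := eps_gt0 n; have h3 : x < a by lra.
  have dd := is_derive_ln_sub _ h3.
  by apply: (@is_derive_continuous _ (fun t : R => ln (a - t) ^+ 2)); exact: is_deriveX.
- have := eps_gt0 n => e0; have := Phi_ge0 (a - (a - eps n)); lra.
- by apply/ge0_integrable_lty => // x; exact: sqr_ge0.
Qed.

Lemma ln_add_sq_integrable :
  mu.-integrable `]- a, a[ (EFin \o (fun t : R => ln (a + t) ^+ 2)).
Proof.
have m : measurable (`]- a, a[%classic : set (measurableTypeR R)) by exact: measurable_itv.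
have na : - a < a by rewrite (lt_trans _ a_gt0) // oppr_lt0.
have dF n (x : R) : - a + eps n <= x <= a ->
    is_derive x 1 (fun t => Phi (a + t)) (ln (a + x) ^+ 2).
  move=> /andP[h1 h2]; have e0 := eps_gt0 n; have h3 : 0 < a + x by lra.
  have h4 := is_derive_addl a x.
  have h5 := @is_derive1_comp _ _ (fun s : R => a + s) x _ _ (is_derive_Phi _ h3) h4.
  by rewrite mulr1 in h5.
have [||||||n|mf If] := @ge0_integral_lty R (fun t => ln (a + t) ^+ 2)
  (fun t => Phi (a + t)) (fun n => - a + eps n) (fun _ => a) `]- a, a[%classic (Phi (a + a)) m.
- by move=> x; exact: sqr_ge0.
- by move=> n; have := eps_le n; have := a_gt0; lra.
- by move=> n k /eps_mono; lra.
- by [].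
- move=> x /=; rewrite in_itv /= => /andP[h1 h2].
  have [|n hn] := eps_small (a + x); first by lra.
  by exists n => //=; rewrite in_itv /= (ltW h2) andbT; lra.
- move=> n x /andP[h1 h2]; have e0 := eps_gt0 n; have h3 : - a < x by lra.
  have dd := is_derive_ln_add _ h3.
  by apply: (@is_derive_continuous _ (fun t : R => ln (a + t) ^+ 2)); exact: is_deriveX.
- have := eps_gt0 n => e0; have := Phi_ge0 (a + (- a + eps n)); lra.
- by apply/ge0_integrable_lty => // x; exact: sqr_ge0.
Qed.

(** The coefficients are bounded on [-a, a], and (x + y + z)^2 <= 3 (x^2 + y^2 + z^2) reduces the
    claim to squared logarithms and constants. Variable coefficients are allowed so that the image
    of [logfun] under the operator is covered as well. *)
Lemma log_comb_sq (c1 c2 c3 : R -> R) : continuous c1 -> continuous c2 -> continuous c3 ->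
  let f t := c1 t * ln (a + t) + c2 t * ln (a - t) + c3 t in
  measurable_fun `]- a, a[ f /\ mu.-integrable `]- a, a[ (EFin \o (fun t => f t ^+ 2)).
Proof.
move=> h1 h2 h3 f.
have m : measurable (`]- a, a[%classic : set (measurableTypeR R)) by exact: measurable_itv.
have na : - a <= a by rewrite ltW // (lt_trans _ a_gt0) // oppr_lt0.
have mc (c : R -> R) : continuous c -> measurable_fun [set: R] c by exact: continuous_measurable_fun.
have mla : measurable_fun [set: R] (fun t : R => ln (a + t)).
  apply: measurableT_comp; first exact: measurable_ln.
  by apply: measurable_funD; [exact: measurable_cst|exact: measurable_id].
have mls : measurable_fun [set: R] (fun t : R => ln (a - t)).
  apply: measurableT_comp; first exact: measurable_ln.
  by apply: measurable_funB; [exact: measurable_cst|exact: measurable_id].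
have mf : measurable_fun [set: R] f.
  apply: measurable_funD; last exact: mc.
  by apply: measurable_funD; apply: measurable_funM => //; exact: mc.
have mf' : measurable_fun `]- a, a[ f by exact: measurable_funTS.
split => //.
have [B1 B10 HB1] := bounded_on _ _ _ na (continuous_subspaceT (A := `[- a, a]%classic) h1).
have [B2 B20 HB2] := bounded_on _ _ _ na (continuous_subspaceT (A := `[- a, a]%classic) h2).
have [B3 B30 HB3] := bounded_on _ _ _ na (continuous_subspaceT (A := `[- a, a]%classic) h3).
have ic : mu.-integrable `[- a, a] (EFin \o (cst 1 : R -> R)).
  by apply: continuous_integrable; apply: continuous_subspaceT => x; exact: cvg_cst.
have {}ic : mu.-integrable `]- a, a[ (EFin \o (cst 1 : R -> R)).
  by apply: integrableS ic => //; exact: subset_itv_oo_cc.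
have i1 := integrableZl m (3 * B1 ^+ 2) ln_add_sq_integrable.
have i2 := integrableZl m (3 * B2 ^+ 2) ln_sub_sq_integrable.
have i3 := integrableZl m (3 * B3 ^+ 2) ic.
have iD := integrableD m (integrableD m i1 i2) i3.
apply: (le_integrable m _ _ iD).
  by apply/measurable_EFinP; exact: measurable_funX.
move=> t /=; rewrite in_itv /= => /andP[t1 t2].
have tt : - a <= t <= a by rewrite !ltW.
have := HB1 _ tt; have := HB2 _ tt; have := HB3 _ tt; rewrite /f.
move: (ln (a + t)) (ln (a - t)) (c1 t) (c2 t) (c3 t) => x y p q r k3 k2 k1.
rewrite lee_fin ger0_norm ?sqr_ge0 // ger0_norm; last first.
  have := sqr_ge0 (B1 * x); have := sqr_ge0 (B2 * y); have := sqr_ge0 B3.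
  by rewrite !exprMn; lra.
have sq (b z : R) : `|z| <= b -> z ^+ 2 <= b ^+ 2.
  by move=> zb; rewrite -(real_normK (num_real z)) lerXn2r // nnegrE (le_trans _ zb).
have s1 := ler_wpM2r (sqr_ge0 x) (sq _ _ k1).
have s2 := ler_wpM2r (sqr_ge0 y) (sq _ _ k2).
have s3 := sq _ _ k3.
have : 0 <= (p * x - q * y) ^+ 2 + (p * x - r) ^+ 2 + (q * y - r) ^+ 2.
  by rewrite !addr_ge0 // sqr_ge0.
move: s1 s2 s3; rewrite !expr2 => s1 s2 s3 s4; nra.
Qed.

Variables (bl br : R) (g g1 g2 : R -> R).
Hypothesis gC2 : C2 g g1 g2.

(** Each logarithm has boundary value b equal to 1 at its own endpoint and 0 at the other, so the
    coefficients are the values b. *)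
Definition logfun (t : R) : R := bl * ln (a + t) + br * ln (a - t) + g t.

Definition logfun1 (t : R) : R := bl / (a + t) - br / (a - t) + g1 t.

Lemma is_derive_logfun (t : R) : - a < t < a -> is_derive t 1 logfun (logfun1 t).
Proof.
move=> /andP[h1 h2]; have d1 := is_derive_ln_add _ h1; have d2 := is_derive_ln_sub _ h2.
have [dg _ _] := gC2; have d3 := dg t.
by apply: is_derive_eq; rewrite /GRing.scale /= /logfun1 mulrN.
Qed.

Lemma derive1_logfun (t : R) : - a < t < a -> derive1 logfun t = logfun1 t.
Proof. by move=> h; apply: is_derive_derive1; exact: is_derive_logfun. Qed.

Lemma is_derive_logfun1 (t : R) : - a < t < a ->
  is_derive t 1 logfun1 (- bl / (a + t) ^+ 2 - br / (a - t) ^+ 2 + g2 t).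
Proof.
move=> /andP[h1 h2]; have [_ dg _] := gC2; have d3 := dg t.
have p0 : a + t != 0 by rewrite gt_eqF //; lra.
have q0 : a - t != 0 by rewrite gt_eqF //; lra.
have d1 : is_derive t 1 (fun s : R => (a + s)^-1) (- (a + t) ^- 2).
  have := @is_deriveV _ (fun s => a + s) t 1 1 p0 (is_derive_addl a t).
  by rewrite /GRing.scale /= mulr1.
have d2 : is_derive t 1 (fun s : R => (a - s)^-1) ((a - t) ^- 2).
  have := @is_deriveV _ (fun s => a - s) t (-1) 1 q0 (is_derive_subl a t).
  by rewrite /GRing.scale /= mulrN1 opprK.
by apply: is_derive_eq; rewrite /GRing.scale /=; field; rewrite p0 q0.
Qed.

(** Since p / (a + t) = (a - t) / a^2, and symmetrically for a - t, the weight cancels the poles of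
    the derivative; only logarithmic singularities remain, which are square integrable. *)
Lemma rprolate_logfun (t : R) : - a < t < a ->
  rprolate a logfun t =
  t ^+ 2 * bl * ln (a + t) + t ^+ 2 * br * ln (a - t) +
  ((bl + br) / a ^+ 2 + prolate_expr a g g1 g2 t).
Proof.
move=> ta; have [dg dg1 _] := gC2; have d := dg1 t; have dp := is_derive_pw a a_gt0 t.
have a0 : a != 0 by rewrite gt_eqF.
have nr : \forall s \near t, (bl * (a - s) - br * (a + s)) / a ^+ 2 + pw a s * g1 s =
    pw a s * derive1 logfun s.
  have : t \in `]- a, a[ by rewrite in_itv.
  move=> /near_in_itvoo; apply: filterS => s; rewrite in_itv /= => sa.
  rewrite derive1_logfun // /logfun1 /pw; case/andP: sa => h1 h2; field.
  by rewrite a0 !gt_eqF //; lra.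
have E : derive1 (fun s => pw a s * derive1 logfun s) t =
    - (bl + br) / a ^+ 2 + (pw a t * g2 t - 2 * t / a ^+ 2 * g1 t).
  apply: is_derive_derive1; apply: near_eq_is_derive nr _; apply: is_derive_eq.
  by rewrite /GRing.scale /=; field.
by rewrite /rprolate E /prolate_expr /logfun; field.
Qed.

Lemma logfun1_lipschitz (c d : R) : - a < c -> c <= d -> d < a ->
  exists2 K : R, 0 <= K & forall x y, c <= x -> x <= y -> y <= d ->
    `|derive1 logfun y - derive1 logfun x| <= K * (y - x).
Proof.
move=> mac cd da; have [_ _ cg2] := gC2.
have ii (x : R) : c <= x <= d -> - a < x < a by move=> /andP[h1 h2]; apply/andP; split; lra.
have [|K K0 HK] := C1_lipschitz c d logfun1
    (fun t => - bl / (a + t) ^+ 2 - br / (a - t) ^+ 2 + g2 t) cd (fun x h => is_derive_logfun1 x (ii x h)).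
  apply: continuous_within => x /ii/andP[h1 h2].
  apply: cvgD; last exact: cg2.
  apply: cvgB; (apply: cvgM; first exact: cvg_cst); apply: cvgV.
  - by rewrite expf_neq0 // gt_eqF //; lra.
  - by apply: (@is_derive_continuous _ (fun x : R => (a + x) ^+ 2)); exact: is_deriveX.
  - by rewrite expf_neq0 // gt_eqF //; lra.
  - by apply: (@is_derive_continuous _ (fun x : R => (a - x) ^+ 2)); exact: is_deriveX.
exists K => // x y cx xy yd.
by rewrite !derive1_logfun; [exact: HK|apply: ii; apply/andP; split; lra..].
Qed.

Let c_g : continuous g. Proof. by have [] := C2_cont _ _ _ gC2. Qed.
Let c_g1 : continuous g1. Proof. by have [] := C2_cont _ _ _ gC2. Qed.
Let na : - a < a. Proof. by rewrite (lt_trans _ a_gt0) // oppr_lt0. Qed.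
Let a2 : a + a != 0. Proof. by rewrite gt_eqF // addr_gt0. Qed.

Lemma logfun_bv_bl : (t + a) * derive1 logfun t @[t --> (- a)^'+] --> bl.
Proof.
have h : bl - br * (t + a) / (a - t) + (t + a) * g1 t @[t --> - a] -->
    bl - br * (- a + a) / (a - - a) + (- a + a) * g1 (- a).
  apply: cvgD; last by apply: cvgM; [apply: cvgD; [exact: cvg_id|exact: cvg_cst]|exact: c_g1].
  apply: cvgB; first exact: cvg_cst.
  apply: cvgM; first by apply: cvgM; [exact: cvg_cst|apply: cvgD; [exact: cvg_id|exact: cvg_cst]].
  apply: cvgV; first by rewrite opprK.
  by apply: cvgB; [exact: cvg_cst|exact: cvg_id].
rewrite addNr mulr0 !mul0r subr0 addr0 in h.
apply: cvg_trans (cvg_at_right_filter h); apply: near_eq_cvg; near=> t.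
have t1 : - a < t by near: t; exact: nbhs_right_gt.
have t2 : t < a by near: t; exact: nbhs_right_lt.
rewrite derive1_logfun ?t1 // /logfun1; field; rewrite !gt_eqF //; lra.
Unshelve. all: by end_near. Qed.

Lemma logfun_bv_br : (t - a) * derive1 logfun t @[t --> a^'-] --> br.
Proof.
have h : br + bl * (t - a) / (a + t) + (t - a) * g1 t @[t --> a] -->
    br + bl * (a - a) / (a + a) + (a - a) * g1 a.
  apply: cvgD; last by apply: cvgM; [apply: cvgB; [exact: cvg_id|exact: cvg_cst]|exact: c_g1].
  apply: cvgD; first exact: cvg_cst.
  apply: cvgM; first by apply: cvgM; [exact: cvg_cst|apply: cvgB; [exact: cvg_id|exact: cvg_cst]].
  apply: cvgV; first exact: a2.
  by apply: cvgD; [exact: cvg_cst|exact: cvg_id].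
rewrite subrr mulr0 !mul0r !addr0 in h.
apply: cvg_trans (cvg_at_left_filter h); apply: near_eq_cvg; near=> t.
have t1 : - a < t by near: t; exact: nbhs_left_gt.
have t2 : t < a by near: t; exact: nbhs_left_lt.
rewrite derive1_logfun ?t1 // /logfun1; field; rewrite !gt_eqF //; lra.
Unshelve. all: by end_near. Qed.

(** The pole of the derivative produces [bl * ln (a + t)], which cancels the singular part of
    [logfun]; the other logarithm contributes its value ln (2a). *)
Lemma logfun_bv_cl : ((t + a) * ln (a + t)) * derive1 logfun t - logfun t @[t --> (- a)^'+] -->
  - br * ln (a + a) - g (- a).
Proof.
have hl : (t + a) * ln (a + t) @[t --> (- a)^'+] --> (0 : R).
  have := xlnx_cvg_right (- a); rewrite opprK.
  by rewrite (_ : (fun t => (t + a) * ln (t + a)) = (fun t => (t + a) * ln (a + t))) //;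
    apply/funext => t; rewrite [in ln _]addrC.
have h1 : g1 t - br / (a - t) @[t --> - a] --> g1 (- a) - br / (a - - a).
  apply: cvgB; first exact: c_g1.
  apply: cvgM; first exact: cvg_cst.
  apply: cvgV; first by rewrite opprK.
  by apply: cvgB; [exact: cvg_cst|exact: cvg_id].
have h2 : - br * ln (a - t) - g t @[t --> - a] --> - br * ln (a - - a) - g (- a).
  apply: cvgB; last exact: c_g.
  apply: cvgM; first exact: cvg_cst.
  exact: (is_derive_continuous _ _ _ (is_derive_ln_sub (- a) na)).
have h : ((t + a) * ln (a + t)) * (g1 t - br / (a - t)) + (- br * ln (a - t) - g t)
    @[t --> (- a)^'+] --> 0 * (g1 (- a) - br / (a - - a)) + (- br * ln (a - - a) - g (- a)).
  by apply: cvgD; [apply: cvgM => //; exact: cvg_at_right_filter|exact: cvg_at_right_filter].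
rewrite opprK mul0r add0r in h.
apply: cvg_trans h; apply: near_eq_cvg; near=> t.
have t1 : - a < t by near: t; exact: nbhs_right_gt.
have t2 : t < a by near: t; exact: nbhs_right_lt.
rewrite derive1_logfun ?t1 // /logfun1 /logfun; field; rewrite !gt_eqF //; lra.
Unshelve. all: by end_near. Qed.

Lemma logfun_bv_cr : ((t - a) * ln (a - t)) * derive1 logfun t - logfun t @[t --> a^'-] -->
  - bl * ln (a + a) - g a.
Proof.
have hl : - ((a - t) * ln (a - t)) @[t --> a^'-] --> - (0 : R).
  by apply: cvgN; exact: xlnx_cvg_left.
have h1 : g1 t + bl / (a + t) @[t --> a] --> g1 a + bl / (a + a).
  apply: cvgD; first exact: c_g1.
  apply: cvgM; first exact: cvg_cst.
  apply: cvgV; first exact: a2.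
  by apply: cvgD; [exact: cvg_cst|exact: cvg_id].
have h2 : - bl * ln (a + t) - g t @[t --> a] --> - bl * ln (a + a) - g a.
  apply: cvgB; last exact: c_g.
  apply: cvgM; first exact: cvg_cst.
  exact: (is_derive_continuous _ _ _ (is_derive_ln_add a na)).
have h : - ((a - t) * ln (a - t)) * (g1 t + bl / (a + t)) + (- bl * ln (a + t) - g t)
    @[t --> a^'-] --> - 0 * (g1 a + bl / (a + a)) + (- bl * ln (a + a) - g a).
  by apply: cvgD; [apply: cvgM => //; exact: cvg_at_left_filter|exact: cvg_at_left_filter].
rewrite oppr0 mul0r add0r in h.
apply: cvg_trans h; apply: near_eq_cvg; near=> t.
have t1 : - a < t by near: t; exact: nbhs_left_gt.
have t2 : t < a by near: t; exact: nbhs_left_lt.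
rewrite derive1_logfun ?t1 // /logfun1 /logfun; field; rewrite !gt_eqF //; lra.
Unshelve. all: by end_near. Qed.

End LogClass.

(** * Cosine and sine transforms *)

Section RealFourier.
Context {R : realType}.
Notation mu := (@lebesgue_measure R).
Variable a : R.
Hypothesis a_gt0 : (0 : R) < a.
Implicit Types (u : R -> R).

Definition cos_transform u (t : R) : R := \int[mu]_(xi in `[- a, a]) (cos (t * xi) * u xi).
Definition sin_transform u (t : R) : R := \int[mu]_(xi in `[- a, a]) (sin (t * xi) * u xi).

Lemma is_derive_mulr (s c : R) : is_derive s 1 (fun x : R => x * c) c.
Proof.
have := is_deriveM (is_derive_id s (1 : R)) (is_derive_cst c s (1 : R)).
by rewrite /GRing.scale /= mulr0 add0r mulr1.
Qed.

Lemma is_derive_mull (s c : R) : is_derive s 1 (fun x : R => c * x) c.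
Proof.
have := is_deriveM (is_derive_cst c s (1 : R)) (is_derive_id s (1 : R)).
by rewrite /GRing.scale /= mulr0 addr0 mulr1.
Qed.

Let mI : measurable (`[- a, a]%classic : set (measurableTypeR R)).
Proof. exact: measurable_itv. Qed.

Lemma continuous_id_mul (c : R) : continuous (fun x : R => c * x).
Proof. by move=> s; exact: (is_derive_continuous _ _ _ (is_derive_mull s c)). Qed.

Lemma continuous_cos_mul (t : R) : continuous (fun xi : R => cos (t * xi)).
Proof.
move=> x; apply: (@continuous_comp _ _ _ (fun xi : R => t * xi) cos).
  exact: continuous_id_mul.
exact: continuous_cos.
Qed.

Lemma continuous_sin_mul (t : R) : continuous (fun xi : R => sin (t * xi)).
Proof.
move=> x; apply: (@continuous_comp _ _ _ (fun xi : R => t * xi) sin).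
  exact: continuous_id_mul.
exact: continuous_sin.
Qed.

Lemma integrable_id_mul u : mu.-integrable `[- a, a] (EFin \o u) ->
  mu.-integrable `[- a, a] (EFin \o (fun xi => xi * u xi)).
Proof. by move=> iu; apply: integrable_mul iu => x; exact: cvg_id. Qed.

(** Since |f1| <= 1, the function |xi u(xi)| dominates the derivative of the integrand for all
    parameters. *)
Lemma is_derive_under_integral (f f1 : R -> R) u : mu.-integrable `[- a, a] (EFin \o u) ->
  (forall x : R, is_derive x 1 f (f1 x)) ->
  continuous f -> (forall x : R, `|f1 x| <= 1) -> forall t : R,
  is_derive t 1 (fun s => \int[mu]_(xi in `[- a, a]) (f (s * xi) * u xi))
    (\int[mu]_(xi in `[- a, a]) (f1 (t * xi) * (xi * u xi))).
Proof.
move=> iu df cf f1le t.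
pose F (s xi : R) := f (s * xi) * u xi.
have dF (s xi : R) : is_derive s 1 (F ^~ xi) (f1 (s * xi) * (xi * u xi)).
  have h := @is_derive1_comp _ f (fun x : R => x * xi) s _ _ (df (s * xi)) (is_derive_mulr s xi).
  have := is_deriveM h (is_derive_cst (u xi) s (1 : R)).
  rewrite /GRing.scale /= mulr0 add0r.
  by rewrite (_ : f1 (s * xi) * (xi * u xi) = u xi * (f1 (s * xi) * xi)) //; ring.
have Ft : (`]t - 1, t + 1[%classic : set R) t by rewrite /= in_itv /=; apply/andP; split; lra.
have intF s : (`]t - 1, t + 1[%classic : set R) s -> mu.-integrable `[- a, a] (EFin \o F s).
  move=> _; apply: integrable_mul iu.
  move=> x; apply: (@continuous_comp _ _ _ (fun xi : R => s * xi) f); last exact: cf.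
  exact: continuous_id_mul.
have derF s y : (`]t - 1, t + 1[%classic : set R) s -> `[- a, a]%classic y -> derivable (F ^~ y) s 1.
  by move=> _ _; apply: ex_derive; exact: dF.
pose G (y : R) := `|y * u y|.
have G0 y : 0 <= G y by exact: normr_ge0.
have intG : mu.-integrable `[- a, a] (EFin \o G).
  by have := integrable_abse (integrable_id_mul _ iu).
have Gub s y : (`]t - 1, t + 1[%classic : set R) s -> `[- a, a]%classic y ->
    `|partial1of2 F s y| <= G y.
  move=> _ _; rewrite partial1of2E (@derive_val _ _ _ _ _ _ _ (dF s y)) normrM.
  by rewrite /G -[leRHS]mul1r; apply: ler_wpM2r.
have D := @derivable_under_integral R _ _ mu F _ mI t _ _ Ft intF derF G G0 intG Gub.
apply: DeriveDef; first exact: D.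
rewrite -derive1E (@differentiation_under_integral R _ _ mu F _ mI t _ _ Ft intF derF G G0 intG Gub).
by apply: eq_Rintegral => y _; rewrite partial1of2E (@derive_val _ _ _ _ _ _ _ (dF t y)).
Qed.

Lemma is_derive_cos_transform u : mu.-integrable `[- a, a] (EFin \o u) -> forall t : R,
  is_derive t 1 (cos_transform u) (- sin_transform (fun xi => xi * u xi) t).
Proof.
move=> iu t; apply: is_derive_eq.
  apply: (is_derive_under_integral cos (fun x => - sin x)) iu _ _ _ t => [x|x].
    exact: continuous_cos.
  by rewrite normrN ler_norml sin_geN1 sin_le1.
rewrite /sin_transform -[RHS]mulN1r -RintegralZl //.
  by apply: eq_Rintegral => y _; rewrite mulN1r mulNr.
exact: integrable_mul (continuous_sin_mul t) (integrable_id_mul _ iu).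
Qed.

Lemma is_derive_sin_transform u : mu.-integrable `[- a, a] (EFin \o u) -> forall t : R,
  is_derive t 1 (sin_transform u) (cos_transform (fun xi => xi * u xi) t).
Proof.
move=> iu t; apply: (is_derive_under_integral sin cos) iu _ _ _ t => [x|x].
  exact: continuous_sin.
by rewrite ler_norml cos_geN1 cos_le1.
Qed.

Lemma C2_cos_transform u : mu.-integrable `[- a, a] (EFin \o u) ->
  C2 (cos_transform u) (fun t => - sin_transform (fun xi => xi * u xi) t)
    (fun t => - cos_transform (fun xi => xi * (xi * u xi)) t).
Proof.
move=> iu; have iu1 := integrable_id_mul _ iu; have iu2 := integrable_id_mul _ iu1.
split=> t; first exact: is_derive_cos_transform.
  exact: is_deriveN (is_derive_sin_transform _ iu1 t).
by apply: cvgN; exact: (is_derive_continuous _ _ _ (is_derive_cos_transform _ iu2 t)).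
Qed.

Lemma C2_sin_transform u : mu.-integrable `[- a, a] (EFin \o u) ->
  C2 (sin_transform u) (cos_transform (fun xi => xi * u xi))
    (fun t => - sin_transform (fun xi => xi * (xi * u xi)) t).
Proof.
move=> iu; have iu1 := integrable_id_mul _ iu; have iu2 := integrable_id_mul _ iu1.
split=> t; first exact: is_derive_sin_transform.
  exact: is_derive_cos_transform.
by apply: cvgN; exact: (is_derive_continuous _ _ _ (is_derive_sin_transform _ iu2 t)).
Qed.

Lemma rprolate_C2 (k k1 k2 : R -> R) (t : R) : C2 k k1 k2 ->
  rprolate a k t = prolate_expr a k k1 k2 t.
Proof.
case=> h1 h2 _; rewrite /rprolate /prolate_expr; congr (- _ + _).
have -> : derive1 k = k1 by apply/funext => s; exact: is_derive_derive1.
have hp := is_derive_pw a a_gt0 t; have h3 := h2 t.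
by apply: is_derive_derive1; apply: is_derive_eq; rewrite /GRing.scale /=; ring.
Qed.

Lemma C2_cos (t : R) : C2 (fun xi => cos (t * xi)) (fun xi => - (t * sin (t * xi)))
  (fun xi => - (t * (t * cos (t * xi)))).
Proof.
split=> x.
- have := @is_derive1_comp _ cos (fun y : R => t * y) x _ _ (is_derive_cos _) (is_derive_mull x t).
  by rewrite mulNr mulrC.
- have h := @is_derive1_comp _ sin (fun y : R => t * y) x _ _ (is_derive_sin _) (is_derive_mull x t).
  have h2 : is_derive x 1 (fun y => t * sin (t * y)) (t * (t * cos (t * x))).
    by apply: is_derive_eq; rewrite /GRing.scale /=; ring.
  exact: is_deriveN h2.
- apply: cvgN; apply: cvgM; first exact: cvg_cst.
  by apply: cvgM; [exact: cvg_cst|exact: continuous_cos_mul].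
Qed.

Lemma C2_sin (t : R) : C2 (fun xi => sin (t * xi)) (fun xi => t * cos (t * xi))
  (fun xi => - (t * (t * sin (t * xi)))).
Proof.
split=> x.
- have := @is_derive1_comp _ sin (fun y : R => t * y) x _ _ (is_derive_sin _) (is_derive_mull x t).
  by rewrite mulrC.
- have h := @is_derive1_comp _ cos (fun y : R => t * y) x _ _ (is_derive_cos _) (is_derive_mull x t).
  by apply: is_derive_eq; rewrite /GRing.scale /=; ring.
- apply: cvgN; apply: cvgM; first exact: cvg_cst.
  by apply: cvgM; [exact: cvg_cst|exact: continuous_sin_mul].
Qed.

Lemma Rintegral_comb3 (x y z : R) (f g h : R -> R) :
  mu.-integrable `[- a, a] (EFin \o f) -> mu.-integrable `[- a, a] (EFin \o g) ->
  mu.-integrable `[- a, a] (EFin \o h) ->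
  x * \int[mu]_(xi in `[- a, a]) f xi + y * \int[mu]_(xi in `[- a, a]) g xi +
    z * \int[mu]_(xi in `[- a, a]) h xi =
  \int[mu]_(xi in `[- a, a]) (x * f xi + y * g xi + z * h xi).
Proof.
move=> jf jg jh.
have i1 := integrableZl mI x jf; have i2 := integrableZl mI y jg.
have i3 := integrableZl mI z jh; have i4 := integrableD mI i1 i2.
by rewrite -!RintegralZl // -RintegralD // -RintegralD.
Qed.

Section Commutation.
Variables (u : R -> R) (bl br : R).
Hypothesis ru : regular a u.
(** The conclusion of [regular_boundary] is assumed for fixed [bl] and [br], so that the same values
    enter the cosine and sine formulas. *)
Hypothesis green : forall k k1 k2, C2 k k1 k2 ->
  \int[mu]_(x in `[- a, a]) green_density a u k k1 k2 x =
  - (2 / a) * (k a * br + k (- a) * bl).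

Let iu : mu.-integrable `[- a, a] (EFin \o u). Proof. by case: ru. Qed.
Let iu1 := integrable_id_mul _ iu.
Let iu2 := integrable_id_mul _ iu1.
Let iLu : mu.-integrable `[- a, a] (EFin \o rprolate a u). Proof. by case: ru. Qed.

Let green_split (k k1 k2 : R -> R) : C2 k k1 k2 ->
  \int[mu]_(x in `[- a, a]) (prolate_expr a k k1 k2 x * u x) -
  \int[mu]_(x in `[- a, a]) (k x * rprolate a u x) =
  - (2 / a) * (k a * br + k (- a) * bl).
Proof.
move=> kk; rewrite -(green _ _ _ kk) -RintegralB //.
- exact: integrable_mul (continuous_prolate_expr _ a_gt0 _ _ _ kk) iu.
- exact: integrable_mul (C2_cont _ _ _ kk).1 iLu.
Qed.

(** Applied in t or in xi, the operator sends cos(t xi) to (t^2 + xi^2 - t^2 xi^2 / a^2) cos(t xi) -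
    (2 t xi / a^2) sin(t xi), which is symmetric. Green's identity then leaves the endpoint values
    of the kernel. *)
Lemma cos_transform_prolate (t : R) :
  rprolate a (cos_transform u) t - cos_transform (rprolate a u) t =
  - (2 / a) * (cos (t * a) * (br + bl)).
Proof.
have := green_split _ _ _ (C2_cos t); rewrite mulrN cosN -mulrDr => <-.
congr (_ - _); rewrite (rprolate_C2 _ _ _ t (C2_cos_transform _ iu)) /prolate_expr.
have a0 : a != 0 by rewrite gt_eqF.
transitivity (pw a t * cos_transform (fun xi => xi * (xi * u xi)) t +
  - (2 * t / a ^+ 2) * sin_transform (fun xi => xi * u xi) t + t ^+ 2 * cos_transform u t).
  by ring.
rewrite Rintegral_comb3.
- by apply: eq_Rintegral => x _; rewrite /pw; field.
- exact: integrable_mul (continuous_cos_mul t) iu2.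
- exact: integrable_mul (continuous_sin_mul t) iu1.
- exact: integrable_mul (continuous_cos_mul t) iu.
Qed.

(** As for the cosine, but the kernel is odd, so the endpoints enter with opposite signs. *)
Lemma sin_transform_prolate (t : R) :
  rprolate a (sin_transform u) t - sin_transform (rprolate a u) t =
  - (2 / a) * (sin (t * a) * (br - bl)).
Proof.
have := green_split _ _ _ (C2_sin t); rewrite mulrN sinN (mulNr (sin _)) -mulrBr => <-.
congr (_ - _); rewrite (rprolate_C2 _ _ _ t (C2_sin_transform _ iu)) /prolate_expr.
have a0 : a != 0 by rewrite gt_eqF.
transitivity (pw a t * sin_transform (fun xi => xi * (xi * u xi)) t +
  2 * t / a ^+ 2 * cos_transform (fun xi => xi * u xi) t + t ^+ 2 * sin_transform u t).
  by ring.
rewrite Rintegral_comb3.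
- by apply: eq_Rintegral => x _; rewrite /pw; field.
- exact: integrable_mul (continuous_sin_mul t) iu2.
- exact: integrable_mul (continuous_cos_mul t) iu1.
- exact: integrable_mul (continuous_sin_mul t) iu.
Qed.

End Commutation.
End RealFourier.

(** * Complex-valued functions *)

Section ComplexAssembly.
Context {R : realType}.
Notation mu := (@lebesgue_measure R).
Variable a : R.
Hypothesis a_gt0 : (0 : R) < a.
Implicit Types (x : R -> R[i]).

Let mD : measurable (`]- a, a[%classic : set (measurableTypeR R)).
Proof. exact: measurable_itv. Qed.
Let na : - a < a. Proof. by rewrite (lt_trans _ a_gt0) // oppr_lt0. Qed.

Lemma Re_scale (r : R) (z : R[i]) : complex.Re (r%:C * z) = r * complex.Re z.
Proof. by case: z => p q /=; rewrite mul0r subr0. Qed.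

Lemma Im_scale (r : R) (z : R[i]) : complex.Im (r%:C * z) = r * complex.Im z.
Proof. by case: z => p q /=; rewrite mul0r addr0. Qed.

Lemma complex_eq (z w : R[i]) :
  complex.Re z = complex.Re w -> complex.Im z = complex.Im w -> z = w.
Proof. by case: z w => p q [p' q'] /= -> ->. Qed.

Lemma re_prolate x : re_fun (prolate a x) = rprolate a (re_fun x).
Proof.
apply/funext => t; rewrite /re_fun /prolate /rprolate raddfD raddfN /= Re_scale.
congr (- derive1 _ t + _); apply/funext => s; rewrite /re_fun Re_scale //.
Qed.

Lemma im_prolate x : im_fun (prolate a x) = rprolate a (im_fun x).
Proof.
apply/funext => t; rewrite /im_fun /prolate /rprolate raddfD raddfN /= Im_scale.
congr (- derive1 _ t + _); apply/funext => s; rewrite /im_fun Im_scale //.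
Qed.

Lemma normc_sqr (z : R[i]) :
  Normc.normc z ^+ 2 = complex.Re z ^+ 2 + complex.Im z ^+ 2.
Proof. by case: z => p q /=; rewrite sqr_sqrtr // addr_ge0 ?sqr_ge0. Qed.

Lemma in_L2_intro x : measurable_fun `]- a, a[ (re_fun x) -> measurable_fun `]- a, a[ (im_fun x) ->
  mu.-integrable `]- a, a[ (EFin \o (fun t => re_fun x t ^+ 2)) ->
  mu.-integrable `]- a, a[ (EFin \o (fun t => im_fun x t ^+ 2)) -> in_L2 `]- a, a[ x.
Proof.
move=> mr mi ir ii; split => //.
have /integrableP[_] := integrableD mD ir ii; apply: le_lt_trans.
rewrite le_eqVlt; apply/orP; left; apply/eqP; apply: eq_integral => t _ /=.
by rewrite normc_sqr ger0_norm // addr_ge0 ?sqr_ge0.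
Qed.

Lemma in_L2_integrable x : in_L2 `]- a, a[ x ->
  mu.-integrable `[- a, a] (EFin \o re_fun x) /\ mu.-integrable `[- a, a] (EFin \o im_fun x).
Proof.
case=> mr mi h.
have mn : measurable_fun `]- a, a[ (fun t => (Normc.normc (x t) ^+ 2)%:E).
  rewrite (_ : (fun t => _) = (fun t => (re_fun x t ^+ 2 + im_fun x t ^+ 2)%:E)).
    by apply/measurable_EFinP; apply: measurable_funD; exact: measurable_funX.
  by apply/funext => t; rewrite normc_sqr.
split; apply: integrable_sq => //; apply: le_lt_trans h; apply: ge0_le_integral => //.
- by move=> t _; rewrite lee_fin sqr_ge0.
- by apply/measurable_EFinP; exact: measurable_funX.
- by move=> t _; rewrite lee_fin normc_sqr lerDl sqr_ge0.
- by move=> t _; rewrite lee_fin sqr_ge0.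
- by apply/measurable_EFinP; exact: measurable_funX.
- by move=> t _; rewrite lee_fin normc_sqr lerDr sqr_ge0.
Qed.

Lemma dom_Lmax_regular x : dom_Lmax a x -> regular a (re_fun x) /\ regular a (im_fun x).
Proof.
case=> /in_L2_integrable[ir ii] [dx acx] /in_L2_integrable[]; rewrite re_prolate im_prolate => jr ji.
split; split => //.
- by move=> t /dx[].
- by move=> c d h1 h2 h3; exact: abs_continuous_Re (acx _ _ h1 h2 h3).
- by move=> t /dx[].
- by move=> c d h1 h2 h3; exact: abs_continuous_Im (acx _ _ h1 h2 h3).
Qed.

Lemma climE (F : set_system R) (FF : ProperFilter F) (f : R -> R[i]) (z : R[i]) :
  re_fun f @ F --> complex.Re z -> im_fun f @ F --> complex.Im z -> clim F f = z.
Proof.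
by move=> h1 h2; apply: complex_eq => /=; apply: cvg_lim => //; exact: norm_hausdorff.
Qed.

Let re_scale_cderiv (f : R -> R) x :
  re_fun (fun t => (f t)%:C * cderiv x t) = (fun t => f t * derive1 (re_fun x) t).
Proof. by apply/funext => t; rewrite /re_fun Re_scale. Qed.

Let im_scale_cderiv (f : R -> R) x :
  im_fun (fun t => (f t)%:C * cderiv x t) = (fun t => f t * derive1 (im_fun x) t).
Proof. by apply/funext => t; rewrite /im_fun Im_scale. Qed.

Lemma bv_blE x z :
  (t + a) * derive1 (re_fun x) t @[t --> (- a)^'+] --> complex.Re z ->
  (t + a) * derive1 (im_fun x) t @[t --> (- a)^'+] --> complex.Im z -> bv_bl a x = z.
Proof. by move=> h1 h2; apply: climE; rewrite ?re_scale_cderiv ?im_scale_cderiv. Qed.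

Lemma bv_brE x z :
  (t - a) * derive1 (re_fun x) t @[t --> a^'-] --> complex.Re z ->
  (t - a) * derive1 (im_fun x) t @[t --> a^'-] --> complex.Im z -> bv_br a x = z.
Proof. by move=> h1 h2; apply: climE; rewrite ?re_scale_cderiv ?im_scale_cderiv. Qed.

Lemma bv_clE x z :
  ((t + a) * ln (a + t)) * derive1 (re_fun x) t - re_fun x t @[t --> (- a)^'+] --> complex.Re z ->
  ((t + a) * ln (a + t)) * derive1 (im_fun x) t - im_fun x t @[t --> (- a)^'+] --> complex.Im z ->
  bv_cl a x = z.
Proof.
move=> h1 h2; apply: climE.
  apply: cvg_trans h1; apply: near_eq_cvg; apply: nearW => t /=.
  by rewrite [RHS]/re_fun raddfB /= mul0r subr0.
apply: cvg_trans h2; apply: near_eq_cvg; apply: nearW => t /=.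
by rewrite [RHS]/im_fun raddfB /= mul0r addr0.
Qed.

Lemma bv_crE x z :
  ((t - a) * ln (a - t)) * derive1 (re_fun x) t - re_fun x t @[t --> a^'-] --> complex.Re z ->
  ((t - a) * ln (a - t)) * derive1 (im_fun x) t - im_fun x t @[t --> a^'-] --> complex.Im z ->
  bv_cr a x = z.
Proof.
move=> h1 h2; apply: climE.
  apply: cvg_trans h1; apply: near_eq_cvg; apply: nearW => t /=.
  by rewrite [RHS]/re_fun raddfB /= mul0r subr0.
apply: cvg_trans h2; apply: near_eq_cvg; apply: nearW => t /=.
by rewrite [RHS]/im_fun raddfB /= mul0r addr0.
Qed.

Section LogClassC.
Variables (bl br : R[i]) (gr gr1 gr2 gi gi1 gi2 : R -> R) (x : R -> R[i]).
Hypotheses (Cr : C2 gr gr1 gr2) (Ci : C2 gi gi1 gi2).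
Hypothesis rex : re_fun x = logfun a (complex.Re bl) (complex.Re br) gr.
Hypothesis imx : im_fun x = logfun a (complex.Im bl) (complex.Im br) gi.

Let logfun_L2 (p q : R) (g g1 g2 : R -> R) : C2 g g1 g2 ->
  measurable_fun `]- a, a[ (logfun a p q g) /\
  mu.-integrable `]- a, a[ (EFin \o (fun t => logfun a p q g t ^+ 2)).
Proof.
move=> Cg; apply: (log_comb_sq a a_gt0 (cst p) (cst q) g).
- by move=> t; exact: cvg_cst.
- by move=> t; exact: cvg_cst.
- exact: (C2_cont _ _ _ Cg).1.
Qed.

Let rprolate_L2 (p q : R) (g g1 g2 : R -> R) : C2 g g1 g2 ->
  measurable_fun `]- a, a[ (rprolate a (logfun a p q g)) /\
  mu.-integrable `]- a, a[ (EFin \o (fun t => rprolate a (logfun a p q g) t ^+ 2)).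
Proof.
move=> Cg.
have csq (r : R) : continuous (fun t : R => t ^+ 2 * r).
  move=> t; apply: cvgM; last exact: cvg_cst.
  by apply: (@is_derive_continuous _ (fun t : R => t ^+ 2)); exact: is_deriveX.
have [|||m1 i1] := log_comb_sq a a_gt0 (fun t => t ^+ 2 * p) (fun t => t ^+ 2 * q)
    (fun t => (p + q) / a ^+ 2 + prolate_expr a g g1 g2 t).
- exact: csq.
- exact: csq.
- move=> t; apply: cvgD; first exact: cvg_cst.
  exact: (continuous_prolate_expr a a_gt0 _ _ _ Cg).
have E t : (`]- a, a[%classic : set R) t -> t ^+ 2 * p * ln (a + t) + t ^+ 2 * q * ln (a - t) +
    ((p + q) / a ^+ 2 + prolate_expr a g g1 g2 t) = rprolate a (logfun a p q g) t.
  by rewrite /= in_itv /= => ta; rewrite (rprolate_logfun a a_gt0 _ _ _ _ _ Cg).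
split.
  by apply: eq_measurable_fun m1 => t /set_mem; exact: E.
apply: eq_integrable i1 => // t /set_mem ta.
by rewrite /= E.
Qed.

Lemma logclass_dom : dom_Lmax a x.
Proof.
split.
- have [m1 i1] := logfun_L2 (complex.Re bl) (complex.Re br) _ _ _ Cr.
  have [m2 i2] := logfun_L2 (complex.Im bl) (complex.Im br) _ _ _ Ci.
  by apply: in_L2_intro; rewrite ?rex ?imx.
- split=> [t ta|c d h1 h2 h3].
    split; [rewrite rex|rewrite imx]; apply: ex_derive.
      exact: (is_derive_logfun a _ _ _ _ _ Cr).
    exact: (is_derive_logfun a _ _ _ _ _ Ci).
  have [K K0 HK] := logfun1_lipschitz a (complex.Re bl) (complex.Re br) _ _ _ Cr _ _ h1 h2 h3.
  have [L L0 HL] := logfun1_lipschitz a (complex.Im bl) (complex.Im br) _ _ _ Ci _ _ h1 h2 h3.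
  apply: (@lipschitz_abs_continuous _ _ _ _ (K + L)); first exact: addr_ge0.
    move=> s t cs st td; have := HK _ _ cs st td; rewrite -rex /re_fun /= => h.
    by apply: le_trans h _; apply: ler_wpM2r; lra.
  move=> s t cs st td; have := HL _ _ cs st td; rewrite -imx /im_fun /= => h.
  by apply: le_trans h _; apply: ler_wpM2r; lra.
- have [m1 i1] := rprolate_L2 (complex.Re bl) (complex.Re br) _ _ _ Cr.
  have [m2 i2] := rprolate_L2 (complex.Im bl) (complex.Im br) _ _ _ Ci.
  by apply: in_L2_intro; rewrite ?re_prolate ?im_prolate ?rex ?imx.
Qed.

Lemma logclass_bl : bv_bl a x = bl.
Proof.
by apply: bv_blE; rewrite ?rex ?imx;
  [exact: (logfun_bv_bl a a_gt0 _ _ _ _ _ Cr)|exact: (logfun_bv_bl a a_gt0 _ _ _ _ _ Ci)].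
Qed.

Lemma logclass_br : bv_br a x = br.
Proof.
by apply: bv_brE; rewrite ?rex ?imx;
  [exact: (logfun_bv_br a a_gt0 _ _ _ _ _ Cr)|exact: (logfun_bv_br a a_gt0 _ _ _ _ _ Ci)].
Qed.

Lemma logclass_cl : bv_cl a x = (- complex.Re br * ln (a + a) - gr (- a)) +i*
  (- complex.Im br * ln (a + a) - gi (- a)).
Proof.
by apply: bv_clE; rewrite ?rex ?imx;
  [exact: (logfun_bv_cl a a_gt0 _ _ _ _ _ Cr)|exact: (logfun_bv_cl a a_gt0 _ _ _ _ _ Ci)].
Qed.

Lemma logclass_cr : bv_cr a x = (- complex.Re bl * ln (a + a) - gr a) +i*
  (- complex.Im bl * ln (a + a) - gi a).
Proof.
by apply: bv_crE; rewrite ?rex ?imx;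
  [exact: (logfun_bv_cr a a_gt0 _ _ _ _ _ Cr)|exact: (logfun_bv_cr a a_gt0 _ _ _ _ _ Ci)].
Qed.

End LogClassC.

Definition fourier_cst : R := (Num.sqrt (2 * pi))^-1.

Lemma fourier_cst_neq0 : fourier_cst != 0.
Proof. by rewrite invr_neq0 // gt_eqF // sqrtr_gt0 mulr_gt0 // pi_gt0. Qed.

Lemma re_cis_mul (s : R) (z : R[i]) :
  complex.Re (cis s * z) = cos s * complex.Re z - sin s * complex.Im z.
Proof. by case: z. Qed.

Lemma im_cis_mul (s : R) (z : R[i]) :
  complex.Im (cis s * z) = cos s * complex.Im z + sin s * complex.Re z.
Proof. by case: z. Qed.

Section FourierC.
Variable x : R -> R[i].
Hypotheses (ir : mu.-integrable `[- a, a] (EFin \o re_fun x))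
  (ii : mu.-integrable `[- a, a] (EFin \o im_fun x)).

Let mI : measurable (`[- a, a]%classic : set (measurableTypeR R)).
Proof. exact: measurable_itv. Qed.

Lemma re_fourier : re_fun (truncated_fourier a x) =
  (fun t => fourier_cst * (cos_transform a (re_fun x) t - sin_transform a (im_fun x) t)).
Proof.
apply/funext => t; rewrite /re_fun /truncated_fourier Re_scale; congr (_ * _).
rewrite /= /cos_transform /sin_transform -RintegralB //.
- by apply: eq_Rintegral => s _; rewrite /re_fun re_cis_mul.
- exact: integrable_mul (continuous_cos_mul t) ir.
- exact: integrable_mul (continuous_sin_mul t) ii.
Qed.

Lemma im_fourier : im_fun (truncated_fourier a x) =
  (fun t => fourier_cst * (cos_transform a (im_fun x) t + sin_transform a (re_fun x) t)).
Proof.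
apply/funext => t; rewrite /im_fun /truncated_fourier Im_scale; congr (_ * _).
rewrite /= /cos_transform /sin_transform -RintegralD //.
- by apply: eq_Rintegral => s _; rewrite /im_fun im_cis_mul.
- exact: integrable_mul (continuous_cos_mul t) ii.
- exact: integrable_mul (continuous_sin_mul t) ir.
Qed.

Lemma C2_comb (p q : R) (f f1 f2 g g1 g2 : R -> R) : C2 f f1 f2 -> C2 g g1 g2 ->
  C2 (fun t => p * (f t + q * g t)) (fun t => p * (f1 t + q * g1 t)) (fun t => p * (f2 t + q * g2 t)).
Proof.
case=> df df1 cf2 [dg dg1 cg2]; split => t.
- have h1 := df t; have h2 := dg t.
  by apply: is_derive_eq; rewrite /GRing.scale /=; ring.
- have h1 := df1 t; have h2 := dg1 t.
  by apply: is_derive_eq; rewrite /GRing.scale /=; ring.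
- apply: cvgM; first exact: cvg_cst.
  by apply: cvgD; [exact: cf2|apply: cvgM; [exact: cvg_cst|exact: cg2]].
Qed.

Lemma C2_ext (f f' f1 f2 : R -> R) : f = f' -> C2 f' f1 f2 -> C2 f f1 f2.
Proof. by move=> ->. Qed.

Lemma fourier_C2 : (exists g1 g2, C2 (re_fun (truncated_fourier a x)) g1 g2) /\
  (exists g1 g2, C2 (im_fun (truncated_fourier a x)) g1 g2).
Proof.
split; do 2 eexists.
- apply: (C2_ext _ (fun t => fourier_cst * (cos_transform a (re_fun x) t +
    (-1) * sin_transform a (im_fun x) t))).
    by rewrite re_fourier; apply/funext => t; rewrite mulN1r.
  exact: C2_comb (C2_cos_transform _ _ ir) (C2_sin_transform _ _ ii).
- apply: (C2_ext _ (fun t => fourier_cst * (cos_transform a (im_fun x) t +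
    1 * sin_transform a (re_fun x) t))).
    by rewrite im_fourier; apply/funext => t; rewrite mul1r.
  exact: C2_comb (C2_cos_transform _ _ ii) (C2_sin_transform _ _ ir).
Qed.

Lemma fourier_dom : [/\ dom_Lmax a (truncated_fourier a x),
  bv_bl a (truncated_fourier a x) = 0, bv_br a (truncated_fourier a x) = 0,
  bv_cl a (truncated_fourier a x) = - truncated_fourier a x (- a) &
  bv_cr a (truncated_fourier a x) = - truncated_fourier a x a].
Proof.
have [[r1 [r2 Cr]] [i1 [i2 Ci]]] := fourier_C2.
(* The transform is C2 on the whole line, hence of logarithmic class with both coefficients 0, and
   its boundary values can be read off. *)
have E g : g = logfun a 0 0 g by apply/funext => t; rewrite /logfun !mul0r !add0r.
have Er : re_fun (truncated_fourier a x) =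
  logfun a (complex.Re (0 : R[i])) (complex.Re (0 : R[i])) (re_fun (truncated_fourier a x)) by exact: E.
have Ei : im_fun (truncated_fourier a x) =
  logfun a (complex.Im (0 : R[i])) (complex.Im (0 : R[i])) (im_fun (truncated_fourier a x)) by exact: E.
split.
- exact: logclass_dom Cr Ci Er Ei.
- exact: logclass_bl Cr Ci Er Ei.
- exact: logclass_br Cr Ci Er Ei.
- rewrite (logclass_cl _ _ _ _ _ _ _ _ _ Cr Ci Er Ei) /= oppr0 !mul0r !sub0r.
  by apply: complex_eq; rewrite /= ?raddfN.
- rewrite (logclass_cr _ _ _ _ _ _ _ _ _ Cr Ci Er Ei) /= oppr0 !mul0r !sub0r.
  by apply: complex_eq; rewrite /= ?raddfN.
Qed.

Lemma rprolate_comb (p q : R) (f f1 f2 g g1 g2 : R -> R) (t : R) : C2 f f1 f2 -> C2 g g1 g2 ->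
  rprolate a (fun t => p * (f t + q * g t)) t = p * (rprolate a f t + q * rprolate a g t).
Proof.
move=> Cf Cg; rewrite (rprolate_C2 a a_gt0 _ _ _ t (C2_comb p q _ _ _ _ _ _ Cf Cg)).
by rewrite (rprolate_C2 a a_gt0 _ _ _ t Cf) (rprolate_C2 a a_gt0 _ _ _ t Cg) /prolate_expr; ring.
Qed.

End FourierC.

(** Real and imaginary parts of b_a e^{ita} + b_{-a} e^{-ita}, regrouped by cos(t a) and sin(t a) so
    that the two coefficients can be separated later. *)
Lemma fourier_prolate_commutator x : dom_Lmax a x ->
  forall t, let k := - (2 / a) * fourier_cst in
  re_fun (prolate a (truncated_fourier a x)) t - re_fun (truncated_fourier a (prolate a x)) t =
    k * (cos (t * a) * complex.Re (bv_br a x + bv_bl a x) -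
         sin (t * a) * complex.Im (bv_br a x - bv_bl a x)) /\
  im_fun (prolate a (truncated_fourier a x)) t - im_fun (truncated_fourier a (prolate a x)) t =
    k * (cos (t * a) * complex.Im (bv_br a x + bv_bl a x) +
         sin (t * a) * complex.Re (bv_br a x - bv_bl a x)).
Proof.
move=> dx t k; have [rr ri] := dom_Lmax_regular _ dx.
have [_ _ ir iLr] := rr; have [_ _ ii iLi] := ri.
have [blr [brr [h1 h2 gr]]] := regular_boundary a a_gt0 _ rr.
have [bli [bri [h3 h4 gi]]] := regular_boundary a a_gt0 _ ri.
(* The convergence of real and imaginary parts identifies the [lim] in [bv_bl] and [bv_br] with the
   values from Green's identity. *)
rewrite (bv_blE x (blr +i* bli) h1 h3) (bv_brE x (brr +i* bri) h2 h4) /=.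
have c1 := cos_transform_prolate a a_gt0 _ _ _ rr gr t.
have s1 := sin_transform_prolate a a_gt0 _ _ _ rr gr t.
have c2 := cos_transform_prolate a a_gt0 _ _ _ ri gi t.
have s2 := sin_transform_prolate a a_gt0 _ _ _ ri gi t.
have jr : mu.-integrable `[- a, a] (EFin \o re_fun (prolate a x)) by rewrite re_prolate.
have ji : mu.-integrable `[- a, a] (EFin \o im_fun (prolate a x)) by rewrite im_prolate.
rewrite re_prolate im_prolate (re_fourier _ jr ji) (im_fourier _ jr ji) re_prolate im_prolate.
have Er : re_fun (truncated_fourier a x) = (fun t => fourier_cst * (cos_transform a (re_fun x) t +
    (-1) * sin_transform a (im_fun x) t)).
  by rewrite re_fourier //; apply/funext => s; rewrite mulN1r.
have Ei : im_fun (truncated_fourier a x) = (fun t => fourier_cst * (cos_transform a (im_fun x) t +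
    1 * sin_transform a (re_fun x) t)).
  by rewrite im_fourier //; apply/funext => s; rewrite mul1r.
rewrite Er Ei.
rewrite (rprolate_comb _ _ _ _ _ _ _ _ t (C2_cos_transform _ _ ir) (C2_sin_transform _ _ ii)).
rewrite (rprolate_comb _ _ _ _ _ _ _ _ t (C2_cos_transform _ _ ii) (C2_sin_transform _ _ ir)).
have mv (p q r : R) : p - q = r -> p = r + q by move=> <-; rewrite subrK.
rewrite (mv _ _ _ c1) (mv _ _ _ s1) (mv _ _ _ c2) (mv _ _ _ s2) /k; split; ring.
Qed.

End ComplexAssembly.

(** * Prescribing boundary values and endpoint values of the transform *)

Section Interpolation.
Context {R : realType}.
Notation mu := (@lebesgue_measure R).
Variable a : R.
Hypothesis a_gt0 : (0 : R) < a.

Let na : - a < a. Proof. by rewrite (lt_trans _ a_gt0) // oppr_lt0. Qed.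
Let mI : measurable (`[- a, a]%classic : set (measurableTypeR R)).
Proof. exact: measurable_itv. Qed.

Lemma logfun_integrable (bl br : R) (g g1 g2 : R -> R) : C2 g g1 g2 ->
  mu.-integrable `[- a, a] (EFin \o logfun a bl br g).
Proof.
move=> Cg; have [|||m i] := log_comb_sq a a_gt0 (cst bl) (cst br) g.
- by move=> t; exact: cvg_cst.
- by move=> t; exact: cvg_cst.
- exact: (C2_cont _ _ _ Cg).1.
apply: integrable_sq => //; apply/ge0_integrable_lty => //.
- exact: measurable_funX.
- by move=> t; exact: sqr_ge0.
Qed.

Lemma Rintegral_odd (f : R -> R) : continuous f -> (forall t, f (- t) = - f t) ->
  \int[mu]_(x in `[- a, a]) f x = 0.
Proof.
move=> cf fN.
have intf := continuous_integrable _ _ _ (continuous_subspaceT (A := `[- a, a]%classic) cf).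
have H : \int[mu]_(x in `[- a, a]) f x = \int[mu]_(x in `[- a, a]) (- 1 * f x).
  have := @integration_by_substitution_oppr R f (- a) a (ltW na).
  rewrite opprK => /(_ (continuous_subspaceT cf)) E; rewrite /Rintegral E.
  by congr fine; apply: eq_integral => t _ /=; rewrite fN mulN1r.
by move: H; rewrite RintegralZl // mulN1r; lra.
Qed.

Lemma cos_transformN (u : R -> R) (t : R) : cos_transform a u (- t) = cos_transform a u t.
Proof. by apply: eq_Rintegral => x _; rewrite mulNr cosN. Qed.

Lemma sin_transformN (u : R -> R) (t : R) : mu.-integrable `[- a, a] (EFin \o u) ->
  sin_transform a u (- t) = - sin_transform a u t.
Proof.
move=> iu; rewrite /sin_transform -[RHS]mulN1r -RintegralZl //.
  by apply: eq_Rintegral => x _; rewrite mulNr sinN mulN1r mulNr.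
exact: integrable_mul (continuous_sin_mul t) iu.
Qed.

(** It vanishes at the endpoints, so multiples of it leave the values c unchanged, and it is
    positive inside, so weighted integrals of cos^2 and sin^2 are positive. *)
Let w (t : R) : R := a ^+ 2 - t ^+ 2.
Let dw (t : R) : is_derive t 1 w (- (2 * t)).
Proof. by apply: is_derive_eq; rewrite /GRing.scale /=; ring. Qed.
Let dcos (t : R) : is_derive t 1 (fun t => cos (a * t)) (- (a * sin (a * t))).
Proof. by have [] := C2_cos a. Qed.
Let dsin (t : R) : is_derive t 1 (fun t => sin (a * t)) (a * cos (a * t)).
Proof. by have [] := C2_sin a. Qed.
Let cw : continuous w.
Proof. by move=> t; exact: is_derive_continuous (dw t). Qed.
Let w_ge0 (t : R) : - a <= t <= a -> 0 <= w t.
Proof. by move=> /andP[h1 h2]; rewrite /w; nra. Qed.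
Let w_gt0 (t : R) : - a < t < a -> 0 < w t.
Proof. by move=> /andP[h1 h2]; rewrite /w; nra. Qed.

Let cwc : continuous (fun t => w t * cos (a * t)).
Proof. by move=> t; apply: cvgM; [exact: cw|exact: continuous_cos_mul]. Qed.
Let cws : continuous (fun t => w t * sin (a * t)).
Proof. by move=> t; apply: cvgM; [exact: cw|exact: continuous_sin_mul]. Qed.

Let Acos : 0 < cos_transform a (fun t => w t * cos (a * t)) a.
Proof.
apply: (@Rintegral_gt0 _ _ _ _ 0); first by rewrite oppr_lt0 a_gt0.
- by move=> t; apply: cvgM; [exact: continuous_cos_mul|exact: cwc].
- move=> t /w_ge0 wt; rewrite mulrCA mulr_ge0 //; exact: sqr_ge0.
- by rewrite mulr0 cos0 !mul1r mulr1 /w expr0n subr0 exprn_gt0.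
Qed.

Let Asin : 0 < sin_transform a (fun t => w t * sin (a * t)) a.
Proof.
(* The sine vanishes at 0, so positivity is tested elsewhere: [a / 2] keeps the point inside the
   interval, and [a^-1] keeps the argument of the sine at most 1, below pi. *)
have h0 : 0 < Num.min (a / 2) a^-1 by rewrite lt_min invr_gt0 a_gt0 divr_gt0.
have h1 : Num.min (a / 2) a^-1 <= a / 2 by rewrite ge_min lexx.
have h2 : Num.min (a / 2) a^-1 <= a^-1 by rewrite ge_min lexx orbT.
move: h0 h1 h2; set t0 := Num.min _ _ => h0 h1 h2.
have t0a : - a < t0 < a by have := a_gt0; move=> ?; apply/andP; split; lra.
apply: (@Rintegral_gt0 _ _ _ _ t0) => //.
- by move=> t; apply: cvgM; [exact: continuous_sin_mul|exact: cws].
- move=> t /w_ge0 wt; rewrite mulrCA mulr_ge0 //; exact: sqr_ge0.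
- have s0 : 0 < sin (a * t0).
    apply: sin_gt0_pi; rewrite mulr_gt0 //=.
    have : a * t0 <= 1 by rewrite -(mulfV (lt0r_neq0 a_gt0)) ler_pM2l.
    by have := pi_ge2 R; lra.
  by rewrite mulr_gt0 // mulr_gt0 // w_gt0.
Qed.

Lemma interpolation_real (bl br cl cr p q : R) : exists g g1 g2 : R -> R,
  [/\ C2 g g1 g2, - br * ln (a + a) - g (- a) = cl, - bl * ln (a + a) - g a = cr,
      cos_transform a (logfun a bl br g) a = p & sin_transform a (logfun a bl br g) a = q].
Proof.
have a0 : a != 0 by rewrite gt_eqF.
(* The affine part adjusts [cl] and [cr]; the two functions vanishing at the
   endpoints then adjust the transforms one at a time, since the cross terms
   are integrals of odd functions. *)
pose L := ln (a + a).
(* These solve [m0 - m1 * a = - br * L - cl] and [m0 + m1 * a = - bl * L - cr]. *)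
pose m0 := - (bl + br) * L / 2 - (cl + cr) / 2.
pose m1 := ((br - bl) * L + cl - cr) / (2 * a).
pose h := logfun a bl br (fun t => m0 + m1 * t).
have C2h : C2 (fun t => m0 + m1 * t) (cst m1) (cst 0).
  split => t; [|exact: is_derive_cst|exact: cvg_cst].
  have := is_deriveD (is_derive_cst m0 t (1 : R)) (is_derive_mull t m1).
  by rewrite add0r.
have ih : mu.-integrable `[- a, a] (EFin \o h) by exact: logfun_integrable C2h.
pose fc t := w t * cos (a * t); pose fs t := w t * sin (a * t).
have ic : mu.-integrable `[- a, a] (EFin \o fc).
  by apply: continuous_integrable; apply: continuous_subspaceT; exact: cwc.
have js : mu.-integrable `[- a, a] (EFin \o fs).
  by apply: continuous_integrable; apply: continuous_subspaceT; exact: cws.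
pose al := (p - cos_transform a h a) / cos_transform a fc a.
pose be := (q - sin_transform a h a) / sin_transform a fs a.
pose g (t : R) := m0 + m1 * t + (al * fc t + be * fs t).
exists g, (fun t => m1 + (al * (- (2 * t) * cos (a * t) - a * (w t * sin (a * t))) +
     be * (- (2 * t) * sin (a * t) + a * (w t * cos (a * t))))),
  (fun t => al * (- 2 * cos (a * t) + 4 * t * a * sin (a * t) - a * a * (w t * cos (a * t))) +
     be * (- 2 * sin (a * t) - 4 * t * a * cos (a * t) - a * a * (w t * sin (a * t)))).
have wN : w (- a) = 0 by rewrite /w sqrrN subrr.
have wa : w a = 0 by rewrite /w subrr.
have gE t : logfun a bl br g t = 1 * h t + al * fc t + be * fs t.
  by rewrite /logfun /h /logfun /g; ring.
(* Since sin(a x) [fc x] equals cos(a x) [fs x], this single integral is the cross term of both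
   transforms. *)
have oddB : \int[mu]_(x in `[- a, a]) (cos (a * x) * fs x) = 0.
  apply: Rintegral_odd => [t|t].
    by apply: cvgM; [exact: continuous_cos_mul|exact: cws].
  by rewrite /fs mulrN cosN sinN /w sqrrN !mulrN.
split.
- split => t.
  + have d1 := is_derive_mull t m1; have d2 := dw t; have d3 := dcos t; have d4 := dsin t.
    by apply: is_derive_eq; rewrite /GRing.scale /=; ring.
  + have d2 := dw t; have d3 := dcos t; have d4 := dsin t.
    by apply: is_derive_eq; rewrite /GRing.scale /=; ring.
  + have d2 := dw t; have d3 := dcos t; have d4 := dsin t.
    by apply/differentiable_continuous/derivable1_diffP; exact: ex_derive.
- by rewrite /g /fc /fs wN /m0 /m1 -/L; field.
- by rewrite /g /fc /fs wa /m0 /m1 -/L; field.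
- rewrite /cos_transform.
  transitivity (1 * cos_transform a h a + al * cos_transform a fc a +
    be * \int[mu]_(x in `[- a, a]) (cos (a * x) * fs x)).
    rewrite Rintegral_comb3.
    + by apply: eq_Rintegral => t _; rewrite gE; ring.
    + exact: integrable_mul (continuous_cos_mul a) ih.
    + exact: integrable_mul (continuous_cos_mul a) ic.
    + exact: integrable_mul (continuous_cos_mul a) js.
  by rewrite oddB mulr0 addr0 mul1r /al divfK ?gt_eqF // addrC subrK.
- rewrite /sin_transform.
  transitivity (1 * sin_transform a h a + al * (\int[mu]_(x in `[- a, a]) (cos (a * x) * fs x)) +
    be * sin_transform a fs a).
    rewrite Rintegral_comb3.
    + by apply: eq_Rintegral => t _; rewrite gE /fs /fc; ring.
    + exact: integrable_mul (continuous_sin_mul a) ih.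
    + exact: integrable_mul (continuous_cos_mul a) js.
    + exact: integrable_mul (continuous_sin_mul a) js.
  by rewrite oddB mulr0 addr0 mul1r /be divfK ?gt_eqF // addrC subrK.
Qed.

Lemma interpolation (bl br cl cr yl yr : R[i]) : exists x : R -> R[i],
  [/\ dom_Lmax a x, bv_bl a x = bl /\ bv_br a x = br, bv_cl a x = cl /\ bv_cr a x = cr &
      truncated_fourier a x (- a) = yl /\ truncated_fourier a x a = yr].
Proof.
pose k : R := 2 * fourier_cst; have f0 := @fourier_cst_neq0 R.
(* Cosine transforms are even and sine transforms odd, so sums and differences of the values at a
   and -a determine the four real targets; [k] is twice the Fourier constant. *)
have [gr [gr1 [gr2 [Cr clr crr pr qr]]]] := interpolation_real (complex.Re bl) (complex.Re br)
  (complex.Re cl) (complex.Re cr) ((complex.Re yl + complex.Re yr) / k) ((complex.Im yr - complex.Im yl) / k).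
have [gi [gi1 [gi2 [Ci cli cri pi qi]]]] := interpolation_real (complex.Im bl) (complex.Im br)
  (complex.Im cl) (complex.Im cr) ((complex.Im yl + complex.Im yr) / k) ((complex.Re yl - complex.Re yr) / k).
pose x (t : R) := logfun a (complex.Re bl) (complex.Re br) gr t +i*
  logfun a (complex.Im bl) (complex.Im br) gi t.
have rex : re_fun x = logfun a (complex.Re bl) (complex.Re br) gr by [].
have imx : im_fun x = logfun a (complex.Im bl) (complex.Im br) gi by [].
have ir : mu.-integrable `[- a, a] (EFin \o re_fun x) by rewrite rex; exact: logfun_integrable Cr.
have ii : mu.-integrable `[- a, a] (EFin \o im_fun x) by rewrite imx; exact: logfun_integrable Ci.
exists x; split.
- exact: (logclass_dom a a_gt0 _ _ _ _ _ _ _ _ _ Cr Ci rex imx).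
- split; first exact: (logclass_bl a a_gt0 _ _ _ _ _ _ _ _ _ Cr Ci rex imx).
  exact: (logclass_br a a_gt0 _ _ _ _ _ _ _ _ _ Cr Ci rex imx).
- rewrite (logclass_cl a a_gt0 _ _ _ _ _ _ _ _ _ Cr Ci rex imx).
  rewrite (logclass_cr a a_gt0 _ _ _ _ _ _ _ _ _ Cr Ci rex imx).
  by rewrite clr crr cli cri; split; apply: complex_eq.
- have rE t := congr1 (fun f => f t) (re_fourier a _ ir ii).
  have iE t := congr1 (fun f => f t) (im_fourier a _ ir ii).
  split; apply: complex_eq.
  + rewrite [LHS]rE cos_transformN sin_transformN // rex imx pr qi /k; field; exact: f0.
  + rewrite [LHS]iE cos_transformN sin_transformN // rex imx pi qr /k; field; exact: f0.
  + rewrite [LHS]rE rex imx pr qi /k; field; exact: f0.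
  + rewrite [LHS]iE rex imx pi qr /k; field; exact: f0.
Qed.

End Interpolation.

(** * Boundary conditions for the transform and commutation *)

Section Main.
Context {R : realType}.
Notation mu := (@lebesgue_measure R).
Variable a : R.
Hypothesis a_gt0 : (0 : R) < a.
Variable U : 'M[R[i]]_2.

Lemma i_neq0 : ('i%C : R[i]) != 0.
Proof. by apply/eqP => /(congr1 (@complex.Im R)) /=; apply/eqP; exact: oner_neq0. Qed.

Lemma fourier_dom_LU (x : R -> R[i]) : dom_Lmax a x ->
  let yl := truncated_fourier a x (- a) in let yr := truncated_fourier a x a in
  dom_LU a U (truncated_fourier a x) <->
  (1 - U 0 0) * yl - U 0 1 * yr = 0 /\ - U 1 0 * yl + (1 - U 1 1) * yr = 0.
Proof.
move=> dx yl yr; have [[_ _ ir _] [_ _ ii _]] := dom_Lmax_regular a a_gt0 _ dx.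
have [D bl br cl cr] := fourier_dom a a_gt0 _ ir ii.
rewrite /dom_LU bl br cl cr -/yl -/yr.
have E1 : (1 + U 0 0) * 0 - 'i%C * (1 - U 0 0) * (- yl) + U 0 1 * 0 + 'i%C * U 0 1 * (- yr) =
   'i%C * ((1 - U 0 0) * yl - U 0 1 * yr) by ring.
have E2 : U 1 0 * 0 + 'i%C * U 1 0 * (- yl) + (1 + U 1 1) * 0 - 'i%C * (1 - U 1 1) * (- yr) =
   'i%C * (- U 1 0 * yl + (1 - U 1 1) * yr) by ring.
rewrite E1 E2; split=> [[_ /eqP + /eqP +]|[-> ->]]; last by rewrite mulr0.
by rewrite !mulf_eq0 !(negbTE i_neq0) /= => /eqP -> /eqP ->.
Qed.

Lemma neq1_witness : U <> 1%:M -> exists wl wr : R[i],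
  ~ ((1 - U 0 0) * wl - U 0 1 * wr = 0 /\ - U 1 0 * wl + (1 - U 1 1) * wr = 0).
Proof.
(* One column of I - U is nonzero; the corresponding standard basis vector is the witness. *)
move=> U1; have [h|h] := pselect (1 - U 0 0 = 0 /\ - U 1 0 = 0); last first.
  by exists 1, 0; rewrite !mulr0 !mulr1 subr0 addr0.
exists 0, 1; rewrite !mulr0 !mulr1 sub0r add0r => -[h1 h2]; apply: U1.
case: h => h3 h4; apply/matrixP => i j; rewrite mxE.
have ord2 (k : 'I_2) : k = 0 \/ k = 1.
  by case: k => [[|[|//]] ?]; [left|right]; apply/val_inj.
have [->|->] := ord2 i; have [->|->] := ord2 j => /=.
- by apply/esym/eqP; rewrite -subr_eq0; apply/eqP.
- by apply/eqP; rewrite -oppr_eq0; apply/eqP.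
- by apply/eqP; rewrite -oppr_eq0; apply/eqP.
- by apply/esym/eqP; rewrite -subr_eq0; apply/eqP.
Qed.

Lemma fourier_prolate_eq (x : R -> R[i]) : dom_Lmax a x -> bv_bl a x = 0 -> bv_br a x = 0 ->
  truncated_fourier a (prolate a x) = prolate a (truncated_fourier a x).
Proof.
move=> dx bl br; apply/funext => t; have [] := fourier_prolate_commutator a a_gt0 _ dx t.
rewrite bl br subrr addr0 /= !mulr0 subrr mulr0 addr0 mulr0 => /eqP + /eqP.
by rewrite !subr_eq0 => /eqP h1 /eqP h2; apply: complex_eq; [exact: esym h1|exact: esym h2].
Qed.

Lemma fourier_prolate_bv (x : R -> R[i]) : dom_Lmax a x ->
  L2_eq `]- a, a[ (truncated_fourier a (prolate a x)) (prolate a (truncated_fourier a x)) ->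
  bv_bl a x = 0 /\ bv_br a x = 0.
Proof.
move=> dx H; have a0 : a != 0 by rewrite gt_eqF.
have {}H : {ae mu, forall t, `]- a, a[%classic t ->
    truncated_fourier a (prolate a x) t = prolate a (truncated_fourier a x) t} := H.
have k0 : - (2 / a) * @fourier_cst R != 0.
  by rewrite mulf_neq0 ?fourier_cst_neq0 // oppr_eq0 mulf_neq0 ?invr_eq0 // pnatr_eq0.
(* By continuity the relation holds on the whole open interval. Then t = 0 isolates [p], and a small
   positive t with sin(t a) > 0 isolates [q]. *)
have trig0 (p q : R) : {ae mu, forall t, - a < t < a -> cos (t * a) * p + sin (t * a) * q = 0} ->
    p = 0 /\ q = 0.
  move=> /ae_eq_continuous H0.
  have {}H0 t : - a < t < a -> cos (t * a) * p + sin (t * a) * q = 0.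
    apply: H0 => s _; apply: cvgD; apply: cvgM; try exact: cvg_cst.
      apply: (@continuous_comp _ _ _ (fun y : R => y * a) cos); last exact: continuous_cos.
      exact: is_derive_continuous (is_derive_mulr s a).
    apply: (@continuous_comp _ _ _ (fun y : R => y * a) sin); last exact: continuous_sin.
    exact: is_derive_continuous (is_derive_mulr s a).
  have p0 : p = 0.
    by have := H0 0; rewrite oppr_lt0 a_gt0 mul0r cos0 sin0 mul0r addr0 mul1r => /(_ isT).
  split => //.
  have h0 : 0 < Num.min (a / 2) a^-1 by rewrite lt_min invr_gt0 a_gt0 divr_gt0.
  have h1 : Num.min (a / 2) a^-1 <= a / 2 by rewrite ge_min lexx.
  have h2 : Num.min (a / 2) a^-1 <= a^-1 by rewrite ge_min lexx orbT.
  move: h0 h1 h2; set t0 := Num.min _ _ => h0 h1 h2.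
  have t0a : - a < t0 < a by have := a_gt0; move=> ?; apply/andP; split; lra.
  have s0 : 0 < sin (t0 * a).
    apply: sin_gt0_pi; rewrite mulr_gt0 //=.
    have : t0 * a <= 1 by rewrite -(mulVf a0) ler_pM2r.
    by have := pi_ge2 R; lra.
  have /eqP := H0 t0 t0a; rewrite p0 mulr0 add0r mulf_eq0 (gt_eqF s0) /=.
  by move/eqP.
have [h1 h2] : complex.Re (bv_br a x + bv_bl a x) = 0 /\ - complex.Im (bv_br a x - bv_bl a x) = 0.
  apply: trig0; move: H; apply: filterS; first exact: (ae_filter_ringOfSetsType mu).
  move=> t Ht ta; have := (fourier_prolate_commutator a a_gt0 _ dx t).1.
  rewrite /re_fun Ht ?subrr; last by rewrite /= in_itv.
  move=> /esym/eqP; rewrite mulf_eq0 (negbTE k0) /= => /eqP.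
  by rewrite mulrN.
have [h3 h4] : complex.Im (bv_br a x + bv_bl a x) = 0 /\ complex.Re (bv_br a x - bv_bl a x) = 0.
  apply: trig0; move: H; apply: filterS; first exact: (ae_filter_ringOfSetsType mu).
  move=> t Ht ta; have := (fourier_prolate_commutator a a_gt0 _ dx t).2.
  rewrite /im_fun Ht ?subrr; last by rewrite /= in_itv.
  by move=> /esym/eqP; rewrite mulf_eq0 (negbTE k0) /= => /eqP.
move: h1 h2 h3 h4; case: (bv_bl a x) (bv_br a x) => p q [p' q'] /= h1 h2 h3 h4.
by split; apply: complex_eq => /=; lra.
Qed.

End Main.

Theorem theorem4p2 (R : realType) (a : R) (U : 'M[R[i]]_2)
    (a_gt0 : 0 < a) (U_unitary : U \is unitarymx) :
  (U = 1%:M ->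
     forall x : R -> R[i], dom_LU a U x ->
       dom_LU a U (truncated_fourier a x) /\
       L2_eq `]- a, a[ (truncated_fourier a (prolate a x))
                       (prolate a (truncated_fourier a x)))
  /\
  (U <> 1%:M ->
     (exists x : R -> R[i],
        [/\ dom_LU a U x,
            dom_LU a U (truncated_fourier a x) &
            ~ L2_eq `]- a, a[ (truncated_fourier a (prolate a x))
                              (prolate a (truncated_fourier a x))]) /\
     (exists x : R -> R[i],
        dom_LU a U x /\ ~ dom_LU a U (truncated_fourier a x))).
Proof.
split=> [U1 x [dx e1 e2]|/neq1_witness[wl [wr W]]].
  have [U00 U01 U10 U11] : [/\ U 0 0 = 1, U 0 1 = 0, U 1 0 = 0 & U 1 1 = 1].
    by rewrite U1 !mxE.
  (* For U = I the boundary conditions are 2 b = 0. *)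
  have two0 : (1 + 1 : R[i]) != 0 by rewrite -mulr2n pnatr_eq0.
  have bl : bv_bl a x = 0.
    by apply: (mulfI two0); rewrite mulr0 -[RHS]e1 U00 U01; ring.
  have br : bv_br a x = 0.
    by apply: (mulfI two0); rewrite mulr0 -[RHS]e2 U10 U11; ring.
  split; last by rewrite fourier_prolate_eq //; exact: aeW.
  apply/(fourier_dom_LU a a_gt0 _ _ dx).
  by rewrite U00 U01 U10 U11 subrr oppr0 !mul0r subr0 addr0.
(* The pair ([dl], [dr]) is (I - U) w. For the first witness b is i times it, hence nonzero, and a
   transform vanishing at both endpoints satisfies the boundary conditions. *)
pose dl := (1 - U 0 0) * wl - U 0 1 * wr; pose dr := - U 1 0 * wl + (1 - U 1 1) * wr.
split.
- have [x [dx [bl br] [cl cr] [yl yr]]] := interpolation a a_gt0 ('i%C * dl) ('i%C * dr)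
    ((1 + U 0 0) * wl + U 0 1 * wr) (U 1 0 * wl + (1 + U 1 1) * wr) 0 0.
  exists x; split.
  + by split => //; rewrite bl br cl cr /dl /dr; ring.
  + by apply/(fourier_dom_LU a a_gt0 _ _ dx); rewrite yl yr !mulr0 subr0 addr0.
  + move=> /(fourier_prolate_bv a a_gt0 _ dx)[]; rewrite bl br => /eqP + /eqP +.
    by rewrite !mulf_eq0 !(negbTE i_neq0) /= => /eqP h1 /eqP h2; apply: W.
- have [x [dx [bl br] [cl cr] [yl yr]]] := interpolation a a_gt0 0 0 0 0 wl wr.
  exists x; split.
  + by split => //; rewrite bl br cl cr !mulr0 ?subr0 ?addr0.
  + by move=> /(fourier_dom_LU a a_gt0 _ _ dx); rewrite yl yr.
Qed.
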